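(* Let $E$, $F$ and $G$ be three normed vector spaces. Let $U$ be a subset of $E$ and $V$ be a subset of $F$. Let $\delta\in(0,\infty)$ and $\gamma\geq 1$. Assume that $(E^{\otimes k})_{k\geq1}$ and $(F^{\otimes k})_{k\geq1}$ are endowed with norms satisfying the projective property. Let $f:U\to F$ be an almost $\mathrm{Lip}-\gamma$ map on domains of size $\delta$ of $U$ and let $g:V\to G$ be a $\mathrm{Lip}-\gamma$ map such that $f(U)\subseteq V$. Then $g\circ f$ (endowed with its successive chain rule derivatives up to order $\lfloor\gamma\rfloor$) is $\mathrm{Lip}-\gamma$ and there exists a constant $C_{\gamma,\delta}$, depending only on $\gamma$ and $\delta$, such that $$\|g\circ f\|_{\mathrm{Lip}-\gamma}\leq C_{\gamma,\delta}\,\|g\|_{\mathrm{Lip}-\gamma}\,\max\left(\|f\|_{\delta,\mathrm{Lip}-\gamma}^{\gamma},1\right).$$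
   Context: Notation. $\mathbb{N}=\{0,1,2,\dots\}$, $\mathbb{N}^*=\mathbb{N}\setminus\{0\}$. For a real number $\gamma>0$, $\lfloor\gamma\rfloor$ denotes the unique integer with $0<\gamma-\lfloor\gamma\rfloor\leq1$ (so $\lfloor\gamma\rfloor=\gamma-1$ when $\gamma$ is an integer). $E^{\otimes k}$ is the $k$-fold algebraic tensor power of $E$, with a fixed norm also denoted $\|\cdot\|$ (on $E^{\otimes 1}=E$ the norm of $E$). $\mathcal{L}_s(E^{\otimes k},F)$ is the space of symmetric $k$-linear mappings from $E$ to $F$, seen as linear maps on $E^{\otimes k}$. Spaces of continuous linear maps carry the operator norm. Lipschitz maps. Let $n\in\mathbb{N}$, $0<\varepsilon\leq1$, $U\subseteq E$ any subset, $f^0:U\to F$ and $f^k:U\to\mathcal{L}_s(E^{\otimes k},F)$ for $1\leq k\leq n$. The remainder of order $k$ ($0\leq k\leq n$) of $f=(f^0,\dots,f^n)$ is defined by $$f^k(x)(v)=\sum_{j=k}^n f^j(y)\Big(\frac{v\otimes(x-y)^{\otimes(j-k)}}{(j-k)!}\Big)+R_k(x,y)(v),\quad x,y\in U,\ v\in E^{\otimes k}.$$ $f$ is $\mathrm{Lip}-(n+\varepsilon)$ on $U$ if there is $M$ such that for all $0\leq k\leq n$, $x,y\in U$, $v_1,\dots,v_k\in E$: $\|f^k(x)(v_1\otimes\cdots\otimes v_k)\|\leq M\|v_1\otimes\cdots\otimes v_k\|$ and $\|R_k(x,y)(v_1\otimes\cdots\otimes v_k)\|\leq M\|x-y\|^{n+\varepsilon-k}\|v_1\otimes\cdots\otimes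 v_k\|$. The smallest such $M$ is $\|f\|_{\mathrm{Lip}-(n+\varepsilon)}$. One often says that $f^0$ is Lip, the maps $f^1,\dots,f^n$ being understood. Almost Lipschitz maps. Let $n\in\mathbb{N}^*$, $0<\varepsilon\leq1$, $\delta\in(0,\infty]$. $f=(f^0,\dots,f^n)$ is almost Lipschitz of degree $n+\varepsilon$ on domains of size $\delta$ of $U$ if $(f^1,\dots,f^n)$ is $\mathrm{Lip}-(n+\varepsilon-1)$, where $f^1:U\to\mathcal{L}(E,F)$ and $f^{k+1}$ is identified with the order-$k$ component $(f^1)^k$ via $(f^1)^k(x)(v_1\otimes\cdots\otimes v_k)(v_{k+1})=f^{k+1}(x)(v_1\otimes\cdots\otimes v_{k+1})$, and if there is $\tilde M\geq0$ with $\|R_0(x,y)\|\leq\tilde M\|x-y\|^{n+\varepsilon}$ for all $x,y\in U$ with $\|x-y\|<\delta$. With $\|R_0\|_{\infty,\delta}$ the smallest such $\tilde M$, $\|f\|_{\delta,\mathrm{Lip}-(n+\varepsilon)}=\max(\|f^1\|_{\mathrm{Lip}-(n+\varepsilon-1)},\|R_0\|_{\infty,\delta})$. For degree $1$ (that is, $n=0$, $\varepsilon=1$) only the condition on $R_0(x,y)=f^0(x)-f^0(y)$ is kept and $\|f\|_{\delta,\mathrm{Lip}-1}=\|R_0\|_{\infty,\delta}$. Chain rule derivatives. With $n=\lfloor\gamma\rfloor$, for $1\leq k\leq n$, $x\in U$, $v\in E^{\otimes k}$, $$(g\circ f)^k(x)(v)=\sum_{j=1}^k\frac{g^j(f^0(x))}{j!}\sum_{\substack{1\leq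 i_1,\dots,i_j\leq n\\ i_1+\cdots+i_j=k}}\frac{f^{i_1}(x)\otimes\cdots\otimes f^{i_j}(x)}{i_1!\cdots i_j!}\Big(\sum_{\sigma\in\mathcal{S}_k}\sigma(v)\Big),$$ where $\sigma(x_1\otimes\cdots\otimes x_k)=x_{\sigma(1)}\otimes\cdots\otimes x_{\sigma(k)}$. Projective property. The norms on $(E^{\otimes k})_{k\geq 1}$ satisfy the projective property if $\|a\otimes b\|\leq\|a\|\|b\|$ for all $a\in E^{\otimes p}$, $b\in E^{\otimes q}$. Standing assumption. The norms on the tensor powers of the base space $E$ satisfy $\|v\otimes\tilde v\|=\|v\|\|\tilde v\|$ for all $k$, $v\in E^{\otimes k}$, $\tilde v\in E$. *)

(* Defs.v *)
From HB Require Import structures.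
From mathcomp Require Import all_boot all_order all_algebra all_fingroup.
From mathcomp Require Import generic_quotient.
From mathcomp Require Import all_classical all_reals all_analysis.
Set Implicit Arguments.
Unset Strict Implicit.
Unset Printing Implicit Defensive.
Import Order.TTheory GRing.Theory Num.Theory.
Import numFieldNormedType.Exports.
Local Open Scope classical_set_scope.
Local Open Scope quotient_scope.
Local Open Scope ring_scope.

(* Algebraic tensor powers.  [tpow E k] is the quotient of the formal linear
   combinations of k-tuples (lists of pairs coefficient, tuple) by the
   relation "every k-linear map takes the same value on both".  Lemma
   [tpow_universal] is the universal property; [E^{(x) 0}] is the scalars. *)

Section Multilinear.
Context {R : comNzRingType} {E : lmodType R}.

Definition upd k (v : k.-tuple E) (i : 'I_k) (x : E) : k.-tuple E :=
  [tuple (if j == i then x else tnth v j) | j < k].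

Definition multilinear k (W : lmodType R) (m : k.-tuple E -> W) :=
  forall (v : k.-tuple E) (i : 'I_k), linear (fun x => m (upd v i x)).

Definition fsum k (W : lmodType R) (m : k.-tuple E -> W)
    (s : seq (R * k.-tuple E)) : W :=
  \sum_(p <- s) p.1 *: m p.2.

Definition teq k (s t : seq (R * k.-tuple E)) : bool :=
  `[< forall (W : lmodType R) (m : k.-tuple E -> W),
        multilinear m -> fsum m s = fsum m t >].

Lemma teq_refl k : reflexive (@teq k).
Proof. by move=> s; apply/asboolP. Qed.

Lemma teq_sym k : symmetric (@teq k).
Proof.
by move=> s t; apply/asboolP/asboolP => h W m hm; rewrite h.
Qed.

Lemma teq_trans k : transitive (@teq k).
Proof.
by move=> t s u /asboolP h1 /asboolP h2; apply/asboolP => W m hm;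
  rewrite h1 // h2.
Qed.

End Multilinear.

Canonical teq_equiv (R : comNzRingType) (E : lmodType R) k :=
  EquivRel (@teq R E k) (@teq_refl R E k) (@teq_sym R E k) (@teq_trans R E k).

Definition tpow (R : comNzRingType) (E : lmodType R) (k : nat) : Type :=
  {eq_quot (@teq R E k)}.

HB.instance Definition _ (R : comNzRingType) (E : lmodType R) k :=
  Choice.on (tpow E k).
HB.instance Definition _ (R : comNzRingType) (E : lmodType R) k :=
  EqQuotient.on (tpow E k).

Section TensorPower.
Context {R : comNzRingType} {E : lmodType R}.
Implicit Types (k : nat) (W : lmodType R).

Let form k := seq (R * k.-tuple E).

Definition tens k (v : k.-tuple E) : tpow E k := \pi_(tpow E k) [:: (1, v)].

(* Linear extension of [m] to [tpow E k]; meaningful when [m] is multilinear. *)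
Definition tlift k W (m : k.-tuple E -> W) (t : tpow E k) : W :=
  fsum m (repr t).

Lemma tlift_pi k W (m : k.-tuple E -> W) (s : form k) :
  multilinear m -> tlift m (\pi_(tpow E k) s) = fsum m s.
Proof.
move=> hm; rewrite /tlift.
have : teq (repr (\pi_(tpow E k) s)) s.
  by rewrite -(@pi_eq_quot _ _ (tpow E k)) reprK.
by move=> /asboolP; exact.
Qed.

Lemma tpow_eqP k (s t : tpow E k) :
  (forall W (m : k.-tuple E -> W), multilinear m -> tlift m s = tlift m t) ->
  s = t.
Proof.
move=> h; rewrite -[s]reprK -[t]reprK; apply/eqP.
rewrite (@pi_eq_quot _ _ (tpow E k)); apply/asboolP => W m hm; exact: h.
Qed.

Lemma fsum_cat k W (m : k.-tuple E -> W) s t :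
  fsum m (s ++ t) = fsum m s + fsum m t.
Proof. by rewrite /fsum big_cat. Qed.

Let fscale k (a : R) (s : form k) : form k := [seq (a * p.1, p.2) | p <- s].

Lemma fsum_scale k W (m : k.-tuple E -> W) a s :
  fsum m (fscale a s) = a *: fsum m s.
Proof.
rewrite /fsum big_map scaler_sumr; apply: eq_bigr => p _.
by rewrite scalerA.
Qed.

Definition tadd k (s t : tpow E k) : tpow E k := \pi_(tpow E k) (repr s ++ repr t).
Definition tscale k (a : R) (s : tpow E k) : tpow E k :=
  \pi_(tpow E k) (fscale a (repr s)).
Definition topp k (s : tpow E k) : tpow E k := tscale (-1) s.
Definition tzero k : tpow E k := \pi_(tpow E k) [::].

Lemma tlift_add k W (m : k.-tuple E -> W) s t : multilinear m ->
  tlift m (tadd s t) = tlift m s + tlift m t.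
Proof. by move=> hm; rewrite tlift_pi // fsum_cat. Qed.

Lemma tlift_scale k W (m : k.-tuple E -> W) a s : multilinear m ->
  tlift m (tscale a s) = a *: tlift m s.
Proof. by move=> hm; rewrite tlift_pi // fsum_scale. Qed.

Lemma tlift_zero k W (m : k.-tuple E -> W) : multilinear m ->
  tlift m (tzero k) = 0.
Proof. by move=> hm; rewrite tlift_pi // /fsum big_nil. Qed.

Lemma taddA k : associative (@tadd k).
Proof. by move=> s t u; apply: tpow_eqP => W m hm; rewrite !tlift_add // addrA. Qed.

Lemma taddC k : commutative (@tadd k).
Proof. by move=> s t; apply: tpow_eqP => W m hm; rewrite !tlift_add // addrC. Qed.

Lemma tadd0 k : left_id (tzero k) (@tadd k).
Proof.
by move=> s; apply: tpow_eqP => W m hm; rewrite tlift_add // tlift_zero // add0r.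
Qed.

Lemma taddN k : left_inverse (tzero k) (@topp k) (@tadd k).
Proof.
move=> s; apply: tpow_eqP => W m hm.
by rewrite tlift_add // tlift_scale // tlift_zero // scaleN1r addNr.
Qed.

HB.instance Definition _ k :=
  GRing.isZmodule.Build (tpow E k) (@taddA k) (@taddC k) (@tadd0 k) (@taddN k).

Lemma tscaleA k a b (v : tpow E k) : tscale a (tscale b v) = tscale (a * b) v.
Proof.
by apply: tpow_eqP => W m hm; rewrite !tlift_scale // scalerA.
Qed.

Lemma tscale1 k : left_id 1 (@tscale k).
Proof. by move=> v; apply: tpow_eqP => W m hm; rewrite tlift_scale // scale1r. Qed.

Lemma tscaleDr k : right_distributive (@tscale k) +%R.
Proof.
move=> a u v; apply: tpow_eqP => W m hm.
by rewrite tlift_scale // !tlift_add // !tlift_scale // scalerDr.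
Qed.

Lemma tscaleDl k (v : tpow E k) : {morph (@tscale k)^~ v : a b / a + b}.
Proof.
move=> a b; apply: tpow_eqP => W m hm.
by rewrite tlift_scale // tlift_add // !tlift_scale // scalerDl.
Qed.

HB.instance Definition _ k := GRing.Zmodule_isLmodule.Build R (tpow E k)
  (@tscaleA k) (@tscale1 k) (@tscaleDr k) (@tscaleDl k).

Lemma tlift_linear k W (m : k.-tuple E -> W) : multilinear m ->
  linear (tlift m).
Proof. by move=> hm a s t; rewrite tlift_add // tlift_scale. Qed.

Lemma tlift_tens k W (m : k.-tuple E -> W) v : multilinear m ->
  tlift m (tens v) = m v.
Proof. by move=> hm; rewrite tlift_pi // /fsum big_seq1 scale1r. Qed.

Lemma tens_multilinear k : multilinear (@tens k).
Proof.
move=> v i a x y; apply: tpow_eqP => W m hm.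
rewrite tlift_linear // !tlift_tens //; exact: hm.
Qed.

Lemma fsum_tens k (s : form k) : fsum (@tens k) s = \pi_(tpow E k) s.
Proof.
apply: tpow_eqP => W m hm; rewrite tlift_pi // /fsum.
elim: s => [|p s IH]; first by rewrite !big_nil tlift_zero.
by rewrite !big_cons tlift_linear // tlift_tens // IH.
Qed.

Lemma tpow_universal k W (m : k.-tuple E -> W) : multilinear m ->
  exists! l : tpow E k -> W, linear l /\ forall v, l (tens v) = m v.
Proof.
move=> hm; exists (tlift m); split.
  by split; [exact: tlift_linear | move=> v; exact: tlift_tens].
move=> l [ll lm]; apply/funext => t.
have l0 : l 0 = 0.
  by have := ll (-1) 0 0; rewrite scaler0 addr0 scaleN1r addNr.
rewrite -[t in RHS]reprK -fsum_tens /tlift /fsum.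
elim: (repr t) => [|p s IH]; first by rewrite !big_nil l0.
by rewrite !big_cons ll lm IH.
Qed.

(* The concatenation product [E^{(x) p} * E^{(x) q} -> E^{(x) (p + q)}]. *)
Definition tcat p q (u : tpow E p) (w : tpow E q) : tpow E (p + q) :=
  tlift (fun s => tlift (fun t => tens (cat_tuple s t)) w) u.

(* [sigma (x_1 (x) ... (x) x_k) = x_(sigma 1) (x) ... (x) x_(sigma k)] *)
Definition tact k (sigma : 'S_k) : tpow E k -> tpow E k :=
  tlift (fun v : k.-tuple E => tens [tuple tnth v (sigma i) | i < k]).

Lemma upd_cat_l p q (s : p.-tuple E) (t : q.-tuple E) i x :
  cat_tuple (upd s i x) t = upd (cat_tuple s t) (lshift q i) x.
Proof.
apply: eq_from_tnth => j; rewrite tnth_mktuple -[j]fintype.splitK.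
case: (fintype.split j) => j' /=; first by rewrite !tnth_lshift tnth_mktuple !(inj_eq (@lshift_inj _ _)).
by rewrite !tnth_rshift eq_rlshift.
Qed.

Lemma upd_cat_r p q (s : p.-tuple E) (t : q.-tuple E) i x :
  cat_tuple s (upd t i x) = upd (cat_tuple s t) (rshift p i) x.
Proof.
apply: eq_from_tnth => j; rewrite tnth_mktuple -[j]fintype.splitK.
case: (fintype.split j) => j' /=; last by rewrite !tnth_rshift tnth_mktuple !(inj_eq (@rshift_inj _ _)).
by rewrite !tnth_lshift eq_lrshift.
Qed.

Lemma cat_multilinear_r p q (s : p.-tuple E) :
  multilinear (fun t : q.-tuple E => tens (cat_tuple s t)).
Proof. by move=> v i a x y; rewrite !upd_cat_r tens_multilinear. Qed.

Lemma cat_multilinear_l p q (w : tpow E q) :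
  multilinear (fun s : p.-tuple E => tlift (fun t => tens (cat_tuple s t)) w).
Proof.
move=> v i a x y; rewrite /tlift /fsum scaler_sumr -big_split /=.
apply: eq_bigr => c _; rewrite !upd_cat_l tens_multilinear.
by rewrite scalerDr !scalerA mulrC.
Qed.

Lemma tcat_tens p q (s : p.-tuple E) (t : q.-tuple E) :
  tcat (tens s) (tens t) = tens (cat_tuple s t).
Proof.
rewrite /tcat tlift_tens; last exact: cat_multilinear_l.
by rewrite tlift_tens //; exact: cat_multilinear_r.
Qed.

Lemma perm_multilinear k (sigma : 'S_k) :
  multilinear (fun v : k.-tuple E => tens [tuple tnth v (sigma i) | i < k]).
Proof.
move=> v i a x y.
have e z : [tuple tnth (upd v i z) (sigma j) | j < k] =
    upd [tuple tnth v (sigma j) | j < k] ((sigma^-1)%g i) z.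
  apply: eq_from_tnth => j; rewrite !tnth_mktuple.
  by rewrite -(inj_eq (@perm_inj _ sigma) j) permKV.
by rewrite !e tens_multilinear.
Qed.

Lemma tact_tens k (sigma : 'S_k) (v : k.-tuple E) :
  tact sigma (tens v) = tens [tuple tnth v (sigma i) | i < k].
Proof. by rewrite /tact tlift_tens //; exact: perm_multilinear. Qed.

End TensorPower.

Section ContinuousLinear.
Context {R : realType} {E F : normedModType R}.

Definition is_clin : {pred E -> F} :=
  fun u => `[< linear u /\ continuous u >].

(* [L(E, F)], with the operator norm as its norm *)
Record clin := Clin { clin_fun :> E -> F; _ : clin_fun \in is_clin }.

HB.instance Definition _ := [isSub for clin_fun].
HB.instance Definition _ := [Choice of clin by <:].

Lemma is_clin_submod : submod_closed is_clin.
Proof.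
split.
  apply/asboolP; split=> [a x y|x]; first by rewrite /= scaler0 addr0.
  exact: cvg_cst.
move=> a u v /asboolP[lu cu] /asboolP[lv cv]; apply/asboolP; split.
  move=> b x y; rewrite !fctE /= lu lv !scalerDr !scalerA [a * b]mulrC.
  by rewrite !addrA; congr (_ + _); rewrite -!addrA; congr (_ + _); rewrite addrC.
move=> x; apply: cvgD; last exact: cv.
apply: cvgZr; exact: cu.
Qed.

HB.instance Definition _ :=
  GRing.isSubmodClosed.Build _ _ is_clin is_clin_submod.
HB.instance Definition _ := [SubChoice_isSubLmodule of clin by <:].

Definition opnorm (u : clin) : R :=
  sup [set `|u x| | x in [set x : E | `|x| <= 1]].

Lemma clin_linear (u : clin) : linear u.
Proof. by case: u => u /= /asboolP[]. Qed.

Lemma clin_continuous (u : clin) : continuous u.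
Proof. by case: u => u /= /asboolP[]. Qed.

HB.instance Definition _ (u : clin) :=
  GRing.isLinear.Build R E F *:%R (clin_fun u) (@clin_linear u).

Lemma clin_bounded (u : clin) : exists2 M : R, 0 <= M &
  forall x, `|u x| <= M * `|x|.
Proof.
have /linear_boundedP : bounded_near u (nbhs (0 : E)).
  by apply: continuous_linear_bounded; exact: clin_continuous.
move=> /pinfty_ex_gt0[M M0 hM]; exists M; [exact: ltW | exact: hM].
Qed.

Let ball1_img (u : clin) := [set `|u x| | x in [set x : E | `|x| <= 1]].

Lemma opnorm_has_sup u : has_sup (ball1_img u).
Proof.
split; first by exists `|u 0|, 0 => //=; rewrite normr0.
have [M M0 hM] := clin_bounded u; exists M => _ [x /= x1 <-].
by rewrite (le_trans (hM x)) // ler_piMr.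
Qed.

Lemma opnorm_ub (u : clin) (x : E) : `|x| <= 1 -> `|u x| <= opnorm u.
Proof.
move=> x1; apply: ub_le_sup; first by have [] := opnorm_has_sup u.
by exists x.
Qed.

Lemma opnorm_le (u : clin) (M : R) :
  (forall x : E, `|x| <= 1 -> `|u x| <= M) -> opnorm u <= M.
Proof.
move=> h; apply: ge_sup; first by have [] := opnorm_has_sup u.
by move=> _ [x /= x1 <-]; exact: h.
Qed.

Lemma opnorm_apply (u : clin) (x : E) : `|u x| <= opnorm u * `|x|.
Proof.
have [->|x0] := eqVneq x 0.
  by rewrite linear0 !normr0 mulr0.
have nx : 0 < `|x| by rewrite normr_gt0.
rewrite -ler_pdivrMr //.
have := @opnorm_ub u (`|x|^-1 *: x).
rewrite linearZ /= !normrZ normfV normr_id mulVf ?gt_eqF // mulrC; exact.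
Qed.

Lemma ler_opnormD (u v : clin) : opnorm (u + v) <= opnorm u + opnorm v.
Proof.
apply: opnorm_le => x x1; apply: le_trans (ler_normD _ _) _.
by rewrite lerD // opnorm_ub.
Qed.

Lemma opnormZ_le (l : R) (u : clin) : opnorm (l *: u) <= `|l| * opnorm u.
Proof.
apply: opnorm_le => x x1.
have -> : (l *: u) x = l *: u x by [].
by rewrite normrZ ler_wpM2l // opnorm_ub.
Qed.

Lemma opnormZ (l : R) (u : clin) : opnorm (l *: u) = `|l| * opnorm u.
Proof.
apply/eqP; rewrite eq_le opnormZ_le /=.
have [->|l0] := eqVneq l 0.
  rewrite normr0 mul0r; apply: le_trans (@opnorm_ub _ 0 _); first exact: normr_ge0.
  by rewrite normr0.
have := opnormZ_le l^-1 (l *: u); rewrite scalerA mulVf // scale1r normfV.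
by rewrite -ler_pdivrMl ?invr_gt0 ?normr_gt0 // invrK.
Qed.

Lemma opnorm0_eq0 (u : clin) : opnorm u = 0 -> u = 0.
Proof.
move=> u0; apply: val_inj; apply/funext => x /=.
by apply/eqP; rewrite -normr_le0 (le_trans (opnorm_apply u x)) // u0 mul0r.
Qed.

HB.instance Definition _ :=
  Lmodule_isNormed.Build R clin ler_opnormD opnormZ opnorm0_eq0.

Lemma clin_normE (u : clin) : `|u| = opnorm u.
Proof. by []. Qed.

(* The continuous linear map with graph [u]; junk value 0 if [u] is not one. *)
Definition mkclin (u : E -> F) : clin := insubd (0 : clin) u.

End ContinuousLinear.
Arguments clin {R} E F.

(* The integer with [0 < gamma - n <= 1]: this is [gamma - 1], not [gamma],
   when gamma is an integer. *)
Definition lfloor (R : realType) (gamma : R) : nat := `|Num.ceil gamma|%N.-1.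

Lemma lfloorP (R : realType) (gamma : R) : 0 < gamma ->
  0 < gamma - (lfloor gamma)%:R <= 1.
Proof.
move=> g0; have c0 : (0 < Num.ceil gamma)%R by rewrite ceil_gt0.
have e : (lfloor gamma).+1%:R = (Num.ceil gamma)%:~R :> R.
  rewrite /lfloor prednK ?absz_gt0 ?gt_eqF //.
  by rewrite -[LHS]/((`|Num.ceil gamma|%N%:Z)%:~R) gtz0_abs.
have -> : (lfloor gamma)%:R = (Num.ceil gamma)%:~R - 1 :> R.
  by rewrite -e -natr1 addrK.
have /andP[h1 h2] := ceil_itv gamma.
rewrite intrB in h1.
by rewrite subr_gt0 h1 /= opprB addrCA gerDl subr_le0.
Qed.

Section Norms.
Context {R : realType}.

Definition is_norm (V : lmodType R) (N : V -> R) :=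
  [/\ forall u v, N (u + v) <= N u + N v,
      forall (a : R) u, N (a *: u) = `|a| * N u
    & forall u, N u = 0 -> u = 0].

(* Norms on the tensor powers of [E]: that of [E] in degree 1 and, by
   convention, the absolute value in degree 0. *)
Definition tensor_norms (E : normedModType R)
    (N : forall k, tpow E k -> R) :=
  [/\ forall k, is_norm (N k),
      N 0 (tens [tuple]) = 1
    & forall x : E, N 1 (tens [tuple x]) = `|x|].

Definition projective (E : normedModType R) (N : forall k, tpow E k -> R) :=
  forall p q (a : tpow E p) (b : tpow E q), (0 < p)%N -> (0 < q)%N ->
    N (p + q) (tcat a b) <= N p a * N q b.

Definition right_multiplicative (E : normedModType R)
    (N : forall k, tpow E k -> R) :=
  forall k (v : tpow E k) (w : E),
    N (k + 1) (tcat v (tens [tuple w])) = N k v * `|w|.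

End Norms.

(* A map [f^0] together with maps [f^k : E -> E^{(x) k} -> W], k >= 1; only
   the values on the set under consideration and the orders 1 <= k <= n matter
   ([jder f 0] never does). *)
Record jet (R : realType) (E W : normedModType R) := Jet {
  jbase : E -> W;
  jder : forall k, E -> tpow E k -> W }.

Section Lipschitz.
Context {R : realType} {E W : normedModType R}.
Variable N : forall k, tpow E k -> R.
Variable U : set E.
Implicit Types (f : jet E W) (n : nat) (eps : R).

(* [f^k] as a map on [E^{(x) k}] for all k, with [W = L(E^{(x) 0}, W)]. *)
Definition jcomp f k (x : E) : tpow E k -> W :=
  match k with
  | 0 => tlift (fun _ : 0.-tuple E => jbase f x)
  | k'.+1 => jder f x
  end.

(* membership in [L_s(E^{(x) k}, W)] *)
Definition symlin k (T : tpow E k -> W) :=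
  linear T /\ forall (sigma : 'S_k) v, T (tact sigma v) = T v.

Definition jet_on n f :=
  forall k x, (1 <= k <= n)%N -> U x -> symlin (@jder _ _ _ f k x).

(* [R_k(x, y)(v)]; the sum is over i = j - k *)
Definition remainder n f k (x y : E) (v : tpow E k) : W :=
  jcomp f x v - \sum_(i < (n - k).+1)
    jcomp f y ((i`!%:R : R)^-1 *: tcat v (tens (nseq_tuple i (x - y)))).

Definition lip_bound n eps f (M : R) :=
  0 <= M /\ forall k x y (v : k.-tuple E), (k <= n)%N -> U x -> U y ->
    `|jcomp f x (tens v)| <= M * N (tens v) /\
    `|remainder n f x y (tens v)|
      <= M * `|x - y| `^ (n%:R + eps - k%:R) * N (tens v).

Definition is_lip n eps f := jet_on n f /\ exists M, lip_bound n eps f M.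

Definition lip_norm n eps f : R := inf [set M | lip_bound n eps f M].

(* the bound on [R_0], for points at distance less than delta *)
Definition rem0_bound n eps (delta : \bar R) f (M : R) :=
  0 <= M /\ forall x y, U x -> U y -> (`|x - y|%:E < delta)%E ->
    `|remainder n f x y (tens [tuple])| <= M * `|x - y| `^ (n%:R + eps).

Definition rem0_norm n eps delta f : R :=
  inf [set M | rem0_bound n eps delta f M].

End Lipschitz.

Section AlmostLipschitz.
Context {R : realType} {E W : normedModType R}.
Variable N : forall k, tpow E k -> R.
Variable U : set E.
Implicit Types (f : jet E W) (n : nat) (eps : R).

(* [f^1 : U -> L(E, W)] with
   [(f^1)^k(x)(v_1 (x) ... (x) v_k)(w) = f^(k+1)(x)(v_1 (x) ... (x) v_k (x) w)] *)
Definition jet_slice f k (x : E) (v : tpow E k) : E -> W :=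
  fun w => jder f x (tcat v (tens [tuple w])).

Definition jet_shift f : jet E (clin E W) :=
  Jet (fun x => mkclin (jet_slice f x (tens [tuple])))
      (fun k x v => mkclin (jet_slice f x v)).

Definition is_alip n eps (delta : \bar R) f :=
  match n with
  | 0 => True
  | n'.+1 =>
      jet_on U n f /\
      (forall k x (v : tpow E k), (k <= n')%N -> U x ->
         continuous (jet_slice f x v)) /\
      is_lip N U n' eps (jet_shift f)
  end /\ exists M, rem0_bound U n eps delta f M.

Definition alip_norm n eps (delta : \bar R) f : R :=
  match n with
  | 0 => rem0_norm U n eps delta f
  | n'.+1 => Num.max (lip_norm N U n' eps (jet_shift f))
                     (rem0_norm U n eps delta f)
  end.

End AlmostLipschitz.

Section ChainRule.
Context {R : realType} {E F G : normedModType R}.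

(* the [p] entries of [v] starting at position [o] *)
Definition block k (v : k.-tuple E) (o p : nat) : p.-tuple E :=
  [tuple nth 0 v (o + a)%N | a < p].

(* [f^{i_1}(x) (x) ... (x) f^{i_j}(x)], applied to consecutive blocks of
   [E^{(x) k}]; meaningful when k is the sum of the i_l. *)
Definition tensor_der (f : jet E F) (x : E) j (i : 'I_j -> nat) k :
    tpow E k -> tpow F j :=
  tlift (fun v : k.-tuple E => tens
    [tuple jder f x (tens (block v (\sum_(m < j | (m < l)%N) i m) (i l)))
    | l < j]).

Definition chain_der n (g : jet F G) (f : jet E F) k (x : E) (v : tpow E k) : G :=
  \sum_(1 <= j < k.+1) (j`!%:R : R)^-1 *:
    \sum_(i : {ffun 'I_j -> 'I_n.+1} |
            [forall l, (0 < i l)%N] && (\sum_l i l == k)%N)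
      jder g (jbase f x)
        (((\prod_l (i l)`!)%:R : R)^-1 *:
           tensor_der f x (fun l => i l) (\sum_(sigma : 'S_k) tact sigma v)).

Definition jet_comp n (g : jet F G) (f : jet E F) : jet E G :=
  Jet (jbase g \o jbase f) (@chain_der n g f).

End ChainRule.

Section Degree.
Context {R : realType} {E W : normedModType R}.
Variable N : forall k, tpow E k -> R.
Variable U : set E.

Definition Lip (gamma : R) (f : jet E W) :=
  is_lip N U (lfloor gamma) (gamma - (lfloor gamma)%:R) f.

Definition LipNorm (gamma : R) (f : jet E W) : R :=
  lip_norm N U (lfloor gamma) (gamma - (lfloor gamma)%:R) f.

Definition AlmostLip (delta : \bar R) (gamma : R) (f : jet E W) :=
  is_alip N U (lfloor gamma) (gamma - (lfloor gamma)%:R) delta f.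

Definition AlmostLipNorm (delta : \bar R) (gamma : R) (f : jet E W) : R :=
  alip_norm N U (lfloor gamma) (gamma - (lfloor gamma)%:R) delta f.

End Degree.

(* Main.v *)
Require Import Defs.
From mathcomp Require Import all_boot all_order all_algebra all_fingroup.
From mathcomp Require Import all_classical all_reals all_analysis.
From mathcomp Require Import ring lra zify.
Set Implicit Arguments.
Unset Strict Implicit.
Unset Printing Implicit Defensive.
Import Order.TTheory GRing.Theory Num.Theory.
Import numFieldNormedType.Exports.
Local Open Scope classical_set_scope.
Local Open Scope ring_scope.

(** A symmetric multilinear map is controlled by its diagonal values
    (polarization), and on the diagonal the jet of a map at [x] becomes the
    polynomial [P_x(z) = \sum_k f^k(x)(z^k) / k!].  The remainders are the
    homogeneous components of [z |-> P_x(z) - P_y(z + (x - y))], so that the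
    Lipschitz bounds for [|x - y|] small amount to
    [|P_x(z) - P_y(z + (x - y))| <= M |x - y|^gamma] for [|z| <= |x - y|].  The
    chain rule says that the polynomial of [g o f] is the composition of those
    of g and f truncated at degree n, and the truncated terms are
    O(|x - y|^(n+1)); hence the estimate for [g o f] follows from those for g
    and f.  When [|x - y|] is bounded below, the bounds on the derivatives alone
    control the remainders. *)

(** The final constant may depend on [gamma] and [delta] only, so every auxiliary estimate fixes its
    constant before quantifying over the spaces. No bound on [f^0] is available, and its remainder
    of order 0 is controlled at distances below [delta] only. Hence [f] enters through the increment
    [P_x(z) - f^0(x)], which is O(|z|), and through the displacement [f^0(x) - f^0(y)] between the
    two centres in [F]. For close points this displacement is O(|x - y|), so a remainder of [g]
    there is O(|x - y|^gamma); raising it to the power gamma is also what produces the power gamma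
    of the norm of [f]. The two properties of tensor norms act at opposite ends. The projective
    property bounds a simple tensor by the product of the norms of its factors, which turns the
    hypotheses on [f] and [g] into bounds by products; multiplicativity on the right gives equality,
    which turns the final bound by products into one by the tensor norm. *)

Ltac perm_count := apply/seq.permP => ?;
  rewrite /= ?(count_cat, count_nseq) /= ?(count_cat, count_nseq); lia.
Ltac size_lia := rewrite ?(size_cat, size_nseq) /= ?(size_cat, size_nseq); lia.

(** * Symmetric multilinear families and their Taylor polynomials *)

Section SymmetricMultilinear.
Context {R : realType} {E W : lmodType R}.
Implicit Types (S T : seq E -> W) (s t : seq E) (n : nat).

(* A family of symmetric multilinear maps of orders at most n, as one map on
   sequences, the order being the length: this avoids the casts between
   [tpow E (p + q)] and [tpow E (q + p)]. *)
Definition symmulti n T :=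
  (forall s t, perm_eq s t -> (size s <= n)%N -> T s = T t) /\
  (forall a u w s, (size s < n)%N ->
     T ((a *: u + w) :: s) = a *: T (u :: s) + T (w :: s)).

Lemma symmulti_le m n T : (m <= n)%N -> symmulti n T -> symmulti m T.
Proof.
move=> mn [hp hl]; split=> [s t st sm|a u w s sm].
  by apply: hp => //; apply: leq_trans mn.
by apply: hl; apply: leq_trans mn.
Qed.

Lemma symmulti0 n T s : symmulti n T -> (size s < n)%N -> T (0 :: s) = 0.
Proof.
move=> [_ hl] sn; have := hl (-1) 0 0 s sn.
by rewrite scaler0 addr0 scaleN1r addNr.
Qed.

Lemma symmultiD n T u w s : symmulti n T -> (size s < n)%N ->
  T ((u + w) :: s) = T (u :: s) + T (w :: s).
Proof. by move=> [_ hl] sn; rewrite -[u in LHS]scale1r hl // scale1r. Qed.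

Lemma symmultiZ n T a u s : symmulti n T -> (size s < n)%N ->
  T ((a *: u) :: s) = a *: T (u :: s).
Proof.
move=> hT sn; rewrite -[a *: u]addr0 hT.2 //.
by rewrite (symmulti0 hT sn) addr0.
Qed.

Lemma symmultiB n T u w s : symmulti n T -> (size s < n)%N ->
  T ((u - w) :: s) = T (u :: s) - T (w :: s).
Proof.
by move=> hT sn; rewrite (symmultiD _ _ hT) // -scaleN1r (symmultiZ _ _ hT) // scaleN1r.
Qed.

Lemma symmulti_sum n T (I : Type) (r : seq I) (P : pred I) (u : I -> E) s :
  symmulti n T -> (size s < n)%N ->
  T ((\sum_(i <- r | P i) u i) :: s) = \sum_(i <- r | P i) T (u i :: s).
Proof.
move=> hT sn; apply: (big_morph (fun v => T (v :: s))).
  by move=> x y; rewrite (symmultiD _ _ hT).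
by rewrite (symmulti0 hT).
Qed.

Lemma symmulti_nseqZ n T a k z s : symmulti n T -> (k + size s <= n)%N ->
  T (nseq k (a *: z) ++ s) = a ^+ k *: T (nseq k z ++ s).
Proof.
move=> hT; elim: k s => [|k IH] s ks; first by rewrite expr0 scale1r.
rewrite /= (symmultiZ _ _ hT) ?size_cat ?size_nseq //.
rewrite (hT.1 _ (nseq k (a *: z) ++ z :: s)); last 2 first.
- by rewrite -cat_cons -cat_rcons perm_cat2r -perm_rcons.
- by rewrite /= size_cat size_nseq.
rewrite IH ?addnS // scalerA exprS; congr (_ *: _).
apply: hT.1; last by rewrite size_cat size_nseq /= addnS.
by rewrite -cat_cons -cat_rcons perm_cat2r perm_rcons.
Qed.

(** The tail [s] carries the induction: one factor [z + d] is split, its half is moved into the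
    tail, and Pascal's rule recombines the two sums. *)
Lemma symmulti_binomial n T z d m s : symmulti n T -> (m + size s <= n)%N ->
  T (nseq m (z + d) ++ s) =
  \sum_(i < m.+1) 'C(m, i)%:R *: T (nseq i z ++ nseq (m - i) d ++ s).
Proof.
move=> hT; elim: m s => [|m IH] s ms.
  by rewrite big_ord_recl big_ord0 bin0 scale1r addr0.
have sw u : T (u :: nseq m (z + d) ++ s) = T (nseq m (z + d) ++ u :: s).
  apply: hT.1; last by rewrite /= size_cat size_nseq.
  by rewrite -cat_cons -cat_rcons perm_cat2r perm_sym perm_rcons.
rewrite /= (symmultiD _ _ hT) ?size_cat ?size_nseq // !sw !IH ?addnS //.
have -> : \sum_(i < m.+1) 'C(m, i)%:R *: T (nseq i z ++ nseq (m - i) d ++ z :: s)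
   = \sum_(i < m.+1) 'C(m, i)%:R *: T (nseq i.+1 z ++ nseq (m.+1 - i.+1) d ++ s).
  apply: eq_bigr => i _; congr (_ *: _); rewrite subSS; apply: hT.1.
    by perm_count.
  by move: (ltn_ord i) => ?; size_lia.
have -> : \sum_(i < m.+1) 'C(m, i)%:R *: T (nseq i z ++ nseq (m - i) d ++ d :: s)
   = \sum_(i < m.+1) 'C(m, i)%:R *: T (nseq i z ++ nseq (m.+1 - i) d ++ s).
  apply: eq_bigr => i _; congr (_ *: _); move: (ltn_ord i) => ?.
  by apply: hT.1; [perm_count | size_lia].
rewrite [RHS]big_ord_recl [X in _ + X]big_ord_recl /= !bin0 addrCA; congr (_ + _).
under [RHS]eq_bigr => i _ do rewrite binS natrD scalerDl.
rewrite big_split /= addrC; congr (_ + _).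
by rewrite [RHS]big_ord_recr /= bin_small // scale0r addr0.
Qed.

Definition taylor n T z : W := \sum_(k < n.+1) (k`!%:R : R)^-1 *: T (nseq k z).

Definition taylor_rem n S T (d : E) s : W :=
  S s - \sum_(i < (n - size s).+1) (i`!%:R : R)^-1 *: T (s ++ nseq i d).

(** Expand each [T (nseq m (z + d))] and collect the terms with k copies of [z]: their coefficient
    C(m, k) / m! is 1 / (k! (m - k)!), as in [taylor_rem]. *)
Lemma taylor_shift n S T z d : symmulti n T ->
  taylor n S z - taylor n T (z + d) =
  \sum_(k < n.+1) (k`!%:R : R)^-1 *: taylor_rem n S T d (nseq k z).
Proof.
move=> hT; under [RHS]eq_bigr => k _ do rewrite scalerBr.
rewrite sumrB; congr (_ - _).
under [RHS]eq_bigr => k _ do rewrite size_nseq.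
(* The degree of truncation is freed from [n], so that it can grow by induction while [T] stays
   fixed. *)
suff H m : (m <= n)%N -> \sum_(k < m.+1) (k`!%:R : R)^-1 *: T (nseq k (z + d)) =
    \sum_(k < m.+1) (k`!%:R : R)^-1 *: \sum_(i < (m - k).+1)
      (i`!%:R : R)^-1 *: T (nseq k z ++ nseq i d) by exact: H.
elim: m => [|m IH] mn.
  rewrite !(big_ord_recl, big_ord0) /=.
  by rewrite fact0 invr1 !scale1r !addr0.
have := symmulti_binomial z d (m := m.+1) (s := [::]) hT.
rewrite cats0 addn0 => /(_ mn) binE.
rewrite big_ord_recr {}binE IH ?(ltnW mn) // [RHS]big_ord_recr subnn.
rewrite [X in _ = _ + _ *: X]big_ord1 /= cats0 fact0 invr1 scale1r.
rewrite [X in _ + _ *: X = _]big_ord_recr binn scale1r subnn /= cats0 scalerDr addrA.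
congr (_ + _).
rewrite scaler_sumr -big_split /=; apply: eq_bigr => i _.
rewrite subSn -1?ltnS // [in RHS]big_ord_recr /= scalerDr; congr (_ + _).
rewrite cats0 !scalerA; congr (_ *: _).
have im : (i <= m.+1)%N by rewrite ltnW.
rewrite -(bin_fact im) natrM [(i`! * _)%:R]natrM subSn -1?ltnS // invfM.
by rewrite mulrAC mulVf ?mul1r ?invfM // pnatr_eq0 -lt0n bin_gt0.
Qed.

(** This makes polarization applicable to the remainders themselves. *)
Lemma symmulti_rem n S T d :
  symmulti n S -> symmulti n T -> symmulti n (taylor_rem n S T d).
Proof.
move=> hS hT; split=> [s t st sn|a u w s sn]; rewrite /taylor_rem.
  have e : size s = size t := perm_size st.
  rewrite (hS.1 _ _ st) // -e; congr (_ - _).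
  apply: eq_bigr => i _; congr (_ *: _); apply: hT.1; first by rewrite perm_cat2r.
  by move: (ltn_ord i) => ?; size_lia.
rewrite hS.2 //= scalerBr addrACA -opprD; congr (_ - _).
rewrite scaler_sumr -big_split /=; apply: eq_bigr => i _.
rewrite /= hT.2; last by move: (ltn_ord i) => /= ?; size_lia.
by rewrite scalerDr !scalerA mulrC.
Qed.

Lemma taylor_rem0 n T s : symmulti n T -> (size s <= n)%N ->
  taylor_rem n T T 0 s = 0.
Proof.
move=> hT sn; rewrite /taylor_rem big_ord_recl /= fact0 invr1 scale1r cats0.
rewrite big1 ?addr0 ?subrr // => i _; rewrite /bump /= add1n.
rewrite (hT.1 _ (0 :: (s ++ nseq i 0))).
- by rewrite (symmulti0 hT) ?scaler0 //; move: (ltn_ord i) => ?; size_lia.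
- by perm_count.
- by move: (ltn_ord i) => /= ?; size_lia.
Qed.

End SymmetricMultilinear.

(** * Coefficient extraction and polarization, with constants independent of the spaces *)

Section Bounds.
Context {R : realType}.

Lemma poly_coef_bound n : exists2 c : R, 0 <= c &
  forall (W : normedModType R) (a : nat -> W) B,
    (forall t : R, 0 <= t <= 1 -> `|\sum_(k < n.+1) t ^+ k *: a k| <= B) ->
    forall k, (k <= n)%N -> `|a k| <= c * B.
Proof.
elim: n => [|n [c c0 IH]].
  exists 1 => // W a B h k; rewrite leqn0 => /eqP ->.
  have := h 0; rewrite big_ord1 expr0 scale1r mul1r; apply.
  by rewrite lexx ler01.
set q := c * (1 + 2 ^+ n.+1).
have q0 : 0 <= q by rewrite mulr_ge0 // addr_ge0 // exprn_ge0.
exists (1 + q * n.+1%:R) => [|W a B h]; first by rewrite addr_ge0 // mulr_ge0.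
have B0 : 0 <= B by apply: le_trans (h 0 _); rewrite ?lexx ?ler01.
(* [p(t) - 2^(n+1) p(t/2)] has degree at most n *)
pose b k := (1 - 2 ^+ n.+1 * 2^-1 ^+ k) *: a k.
have hb k : (k <= n)%N -> `|b k| <= q * B.
  move=> kn; rewrite /q -mulrA; apply: IH => // t /andP[t0 t1].
  have -> : \sum_(k < n.+1) t ^+ k *: b k = \sum_(k < n.+2) t ^+ k *: a k -
      2 ^+ n.+1 *: \sum_(k < n.+2) (t / 2) ^+ k *: a k.
    rewrite scaler_sumr -sumrB [RHS]big_ord_recr /= expr_div_n.
    rewrite [X in _ - X]scalerA mulrCA divff ?expf_neq0 // mulr1 subrr addr0.
    apply: eq_bigr => i _; rewrite /b !scalerA -scalerBl; congr (_ *: _).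
    by rewrite mulrBr mulr1 exprMn mulrCA.
  rewrite (le_trans (ler_normB _ _)) // mulrDl mul1r lerD //.
    by apply: h; rewrite t0.
  rewrite normrZ ger0_norm ?exprn_ge0 // ler_wpM2l ?exprn_ge0 // h //.
  by rewrite divr_ge0 //= ler_pdivrMr // mul1r (le_trans t1) // ler1n.
(* For [k <= n] the factor 2^(n+1-k) - 1 is at least 1, so [a k] is no larger than [b k]. The top
   coefficient is then p(1) minus the others. *)
have ha k : (k <= n)%N -> `|a k| <= q * B.
  move=> kn; apply: le_trans (hb k kn); rewrite /b normrZ ler_peMl //.
  rewrite distrC -[n.+1](subnK (leqW kn)) exprD -mulrA -exprMn divff // expr1n mulr1.
  rewrite ger0_norm ?subr_ge0 ?exprn_ege1 ?ler1n // lerBrDr subSn // exprS.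
  by rewrite -[leLHS]mulr1 ler_pM // exprn_ege1 // ler1n.
have qB : 0 <= q * B by rewrite mulr_ge0.
move=> k; rewrite leq_eqVlt => /predU1P[->|]; last first.
  rewrite ltnS => kn; rewrite (le_trans (ha k kn)) // ler_wpM2r //.
  by rewrite -[leLHS]mulr1 (le_trans (ler_wpM2l q0 (_ : 1 <= n.+1%:R))) ?ler1n // lerDr.
have -> : a n.+1 = \sum_(k < n.+2) 1 ^+ k *: a k - \sum_(k < n.+1) 1 ^+ k *: a k.
  by rewrite [X in X - _]big_ord_recr /= addrAC subrr add0r expr1n scale1r.
rewrite (le_trans (ler_normB _ _)) // mulrDl mul1r lerD //.
  by apply: h; rewrite ler01 lexx.
rewrite mulrAC mulr_natr (le_trans (ler_norm_sum _ _ _)) //.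
rewrite -[n.+1 in leRHS]card_ord -sumr_const; apply: ler_sum => i _.
by rewrite expr1n scale1r ha // -ltnS.
Qed.

(** Adding the constants of the degrees up to [n] gives one that suits them all. *)
Lemma uniform_const (P : nat -> R -> Prop) n :
  (forall k c c', c <= c' -> P k c -> P k c') ->
  (forall k, exists2 c, 0 <= c & P k c) ->
  exists2 c, 0 <= c & forall k, (k <= n)%N -> P k c.
Proof.
move=> mon ex; elim: n => [|n [c c0 hc]].
  by have [c c0 hc] := ex 0%N; exists c => // k; rewrite leqn0 => /eqP ->.
have [c' c'0 hc'] := ex n.+1; exists (c + c'); first exact: addr_ge0.
move=> k; rewrite leq_eqVlt => /predU1P[->|kn].
  by apply: mon hc'; rewrite lerDr.
by apply: mon (hc _ kn); rewrite lerDl.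
Qed.

(* [(k - m) T(w, z, .., z, s)] is the coefficient of [t] in
   [T(t w + z, .., t w + z, s)]. *)
Lemma polarization_step k m : (m <= k)%N -> exists2 c : R, 0 <= c &
  forall (E W : normedModType R) (T : seq E -> W) (B : R), 0 <= B -> symmulti k T ->
    (forall z, `|T (nseq k z)| <= B * `|z| ^+ k) ->
    forall s z, size s = m -> (forall u, u \in s -> `|u| <= 1) ->
      `|z| <= 2 ^+ (k - m) -> `|T (nseq (k - m) z ++ s)| <= c * B.
Proof.
elim: m => [_|m IH mk].
  exists ((2 ^+ k) ^+ k); first by rewrite !exprn_ge0.
  move=> E W T B B0 hT hB s z /size0nil -> _; rewrite subn0 cats0 => zk.
  apply: le_trans (hB z) _; rewrite mulrC ler_wpM2r //.
  by rewrite lerXn2r // nnegrE ?exprn_ge0.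
have [c c0 hc] := IH (ltnW mk).
have [c1 c10 hc1] := poly_coef_bound (k - m).
exists (c1 * c); first exact: mulr_ge0.
move=> E W T B B0 hT hB [//|w s] z [sm] hs zk.
have km : (k - m = (k - m.+1).+1)%N by rewrite subnSK.
have hs' u : u \in s -> `|u| <= 1 by move=> us; apply: hs; rewrite inE us orbT.
have w1 : `|w| <= 1 by apply: hs; rewrite mem_head.
pose a j := ('C(k - m, j)%:R : R) *: T (nseq j w ++ nseq (k - m - j) z ++ s).
have h := hc1 W a (c * B).
have sk : (k - m + size s <= k)%N by rewrite sm subnK // ltnW.
have -> : T (nseq (k - m.+1) z ++ w :: s) = ((k - m)%:R^-1 : R) *: a 1%N.
  rewrite /a bin1 scalerA mulVf ?scale1r; last by rewrite km pnatr_eq0.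
  rewrite subn1 km /=; apply: hT.1; first by perm_count.
  by size_lia.
rewrite normrZ ger0_norm ?invr_ge0 // (@le_trans _ _ `|a 1%N|) //.
  by rewrite ler_piMl // invf_le1 ?km ?ltr0n // ler1n.
rewrite -mulrA; apply: h => [t /andP[t0 t1]|]; last by rewrite km.
have -> : \sum_(j < (k - m).+1) t ^+ j *: a j = T (nseq (k - m) (t *: w + z) ++ s).
  rewrite (symmulti_binomial _ _ hT) //; apply: eq_bigr => j _.
  rewrite (symmulti_nseqZ _ _ hT) ?scalerA 1?mulrC //.
  by move: (ltn_ord j) => ?; size_lia.
apply: hc hs' _ => //.
(* The radius allowed for [z] starts at 2^k and is halved at each extraction, because |t w + z| is
   at most 1 + 2^(k-m-1), hence at most 2^(k-m). *)
rewrite (le_trans (ler_normD _ _)) // normrZ ger0_norm // km exprS mulrDl mul1r.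
rewrite lerD // (le_trans _ (exprn_ege1 _ _)) ?ler1n //.
by rewrite -[1]mulr1 ler_pM.
Qed.

Lemma symmulti_scale_prod (E W : lmodType R) (T : seq E -> W) n (I : Type)
    (c : I -> R) (u : I -> E) s t : symmulti n T -> (size s + size t <= n)%N ->
  T (map (fun x => c x *: u x) s ++ t) =
    (\prod_(x <- s) c x) *: T (map u s ++ t).
Proof.
move=> hT; elim: s t => [|x s IH] t st; first by rewrite big_nil scale1r.
rewrite /= (symmultiZ _ _ hT) ?size_cat ?size_map // big_cons -scalerA.
congr (_ *: _).
rewrite (hT.1 _ (map (fun x => c x *: u x) s ++ u x :: t)); last 2 first.
- by rewrite -cat_cons -cat_rcons perm_cat2r -perm_rcons.
- by rewrite /= size_cat size_map.
rewrite IH ?addnS //; congr (_ *: _); apply: hT.1.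
- by rewrite -cat_cons -cat_rcons perm_cat2r perm_rcons.
- by rewrite size_cat size_map /= addnS.
Qed.

(** Writing each [x] as [|x| *: (|x|^-1 *: x)], which also holds for [x = 0], reduces to arguments
    of norm at most 1. Then all k arguments are extracted; no copy of [z] is left and [z = 0]
    serves. *)
Lemma polarization k : exists2 c : R, 0 <= c &
  forall (E W : normedModType R) (T : seq E -> W) (B : R), 0 <= B -> symmulti k T ->
    (forall z, `|T (nseq k z)| <= B * `|z| ^+ k) ->
    forall s, size s = k -> `|T s| <= c * B * \prod_(u <- s) `|u|.
Proof.
have [c c0 hc] := polarization_step (leqnn k); exists c => //.
move=> E W T B B0 hT hB s sk.
have -> : T s = T (map (fun x => `|x| *: (`|x|^-1 *: x)) s ++ [::]).
  rewrite cats0 -[in LHS](map_id s); congr T; apply: eq_map => x.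
  have [->|x0] := eqVneq x 0; first by rewrite !scaler0.
  by rewrite scalerA divff ?scale1r // normr_eq0.
rewrite (symmulti_scale_prod _ _ hT) ?addn0 ?sk // normrZ mulrC.
rewrite ger0_norm ?prodr_ge0 // ler_wpM2r ?prodr_ge0 //.
have := hc E W T B B0 hT hB (map (fun x => `|x|^-1 *: x) s) 0.
rewrite subnn cats0 normr0; apply => //; first by rewrite size_map.
move=> _ /mapP[x _ ->]; rewrite normrZ normfV normr_id.
by have [->|x0] := eqVneq x 0; rewrite ?normr0 ?mulr0 // mulVf // normr_eq0.
Qed.

End Bounds.

(** * Composition of Taylor polynomials and its truncation *)

Lemma prod_nseq (R : comPzRingType) (I : Type) k (z : I) (F : I -> R) :
  \prod_(u <- nseq k z) F u = F z ^+ k.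
Proof. by rewrite big_nseq iter_mulr_1. Qed.

Lemma sum_ffun_recl (V : nmodType) (I : finType) j (F : {ffun 'I_j.+1 -> I} -> V) :
  \sum_phi F phi = \sum_i \sum_(phi : {ffun 'I_j -> I})
     F [ffun l => if unlift ord0 l is Some l' then phi l' else i].
Proof.
rewrite pair_bigA /=.
rewrite (reindex (fun p : I * {ffun 'I_j -> I} =>
  [ffun l => if unlift ord0 l is Some l' then p.2 l' else p.1])) //=.
exists (fun phi => (phi ord0, [ffun l => phi (lift ord0 l)])).
  move=> [i phi] _ /=; rewrite ffunE unlift_none; congr (_, _).
  by apply/ffunP => l; rewrite !ffunE liftK.
move=> phi _; apply/ffunP => l; rewrite ffunE /=.
by case: unliftP => [l' ->|->] //; rewrite ffunE.
Qed.

Lemma forall_ordS j (P : pred 'I_j.+1) :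
  [forall l, P l] = P ord0 && [forall l, P (lift ord0 l)].
Proof.
apply/forallP/andP => [h|[h0 /forallP h] l]; first by split=> //; apply/forallP.
by case: (unliftP ord0 l) => [l' ->|->].
Qed.

Section Composition.
Context {R : realType}.

(** Equal terms are not merged: the sum runs over ordered multi-indices, as it does in the chain
    rule. *)
Lemma symmulti_expand (E W : lmodType R) (T : seq E -> W) n (I : finType)
    (P : pred I) (a : I -> E) j s : symmulti n T -> (j + size s <= n)%N ->
  T (nseq j (\sum_(i | P i) a i) ++ s) =
  \sum_(phi : {ffun 'I_j -> I} | [forall l, P (phi l)])
    T ([seq a (phi l) | l <- enum 'I_j] ++ s).
Proof.
move=> hT; elim: j s => [|j IH] s js.
  rewrite (eq_bigr (fun=> T s)); last by move=> phi _; rewrite enum_ord0.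
  rewrite (eq_bigl xpredT); last by move=> phi; apply/forallP => -[].
  by rewrite sumr_const card_ffun card_ord expn0 mulr1n.
rewrite [RHS]big_mkcond sum_ffun_recl /= (symmulti_sum _ _ _ hT); last first.
  by rewrite size_cat size_nseq.
rewrite big_mkcond; apply: eq_bigr => i _.
rewrite -big_mkcond.
rewrite [RHS](eq_big (fun phi : {ffun 'I_j -> I} => P i && [forall l, P (phi l)])
   (fun phi => T (a i :: [seq a (phi l) | l <- enum 'I_j] ++ s))); first last.
- move=> phi _; rewrite enum_ordSl /= ffunE unlift_none -map_comp.
  congr (T (_ :: (_ ++ _))); apply: eq_map => l /=; by rewrite ffunE liftK.
- move=> phi; rewrite forall_ordS ffunE unlift_none; congr (_ && _).
  by apply: eq_forallb => l; rewrite ffunE liftK.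
case: (P i) => /=; last by rewrite big_pred0_eq.
have sw (t : seq E) : size t = j -> T (a i :: t ++ s) = T (t ++ a i :: s).
  by move=> sj; apply: hT.1; [perm_count | rewrite /= size_cat sj].
rewrite sw ?size_nseq // IH ?addnS //.
by apply: eq_bigr => phi _; rewrite sw // size_map size_enum_ord.
Qed.

(** Telescoping: the copies of [a] are replaced by [b] one at a time, each exchange leaving one
    argument [a - b] and [m - 1] arguments of norm at most [rho]. *)
Lemma symmulti_lipschitz (E W : normedModType R) (T : seq E -> W) n (M rho : R)
    (a b : E) m s : 0 <= M -> symmulti n T ->
  (forall s, (size s <= n)%N -> `|T s| <= M * \prod_(u <- s) `|u|) ->
  `|a| <= rho -> `|b| <= rho -> (m + size s <= n)%N ->
  `|T (nseq m a ++ s) - T (nseq m b ++ s)| <=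
    m%:R * M * rho ^+ m.-1 * `|a - b| * \prod_(u <- s) `|u|.
Proof.
move=> M0 hT hM ha hb; have rho0 : 0 <= rho by apply: le_trans ha.
elim: m s => [|m IH] s ms; first by rewrite subrr normr0 !mul0r.
have sw u : T (u :: nseq m a ++ s) = T (nseq m a ++ u :: s).
  by apply: hT.1; [perm_count | size_lia].
have -> : T (nseq m.+1 a ++ s) - T (nseq m.+1 b ++ s) =
    (T (nseq m a ++ a :: s) - T (nseq m b ++ a :: s)) +
    T ((a - b) :: nseq m b ++ s).
  rewrite (symmultiB _ _ hT); last by size_lia.
  rewrite /= sw addrA; congr (_ - _).
  rewrite -addrA -[LHS]addr0; congr (_ + _); rewrite addrC.
  have -> : T (nseq m b ++ a :: s) = T (a :: nseq m b ++ s).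
    by apply: hT.1; [perm_count | size_lia].
  by rewrite subrr.
rewrite (le_trans (ler_normD _ _)) //.
have := IH (a :: s); rewrite big_cons /= addnS => /(_ ms) h1.
have := hM ((a - b) :: nseq m b ++ s).
rewrite big_cons big_cat /= prod_nseq size_cat size_nseq => /(_ ms) h2.
have p0 : 0 <= \prod_(u <- s) `|u| by rewrite prodr_ge0.
set p := \prod_(u <- s) _ in h1 h2 p0 *.
have -> : m.+1%:R * M * rho ^+ m * `|a - b| * p =
  m%:R * M * rho ^+ m * `|a - b| * p + M * (`|a - b| * (rho ^+ m * p)).
  by rewrite -natr1; ring.
apply: lerD.
  apply: le_trans h1 _; case: (m) => [|k]; first by rewrite !mul0r.
  rewrite exprSr /= -!mulrA !ler_wpM2l // ?exprn_ge0 //.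
  by rewrite mulrCA ler_wpM2r // mulr_ge0.
apply: le_trans h2 _; rewrite ler_wpM2l // ler_wpM2l // ler_wpM2r //.
by rewrite lerXn2r // nnegrE.
Qed.

(** The Taylor polynomial without its constant term, that is, the part of the polynomial of [f] that
    its almost Lipschitz norm bounds. *)
Definition taylor_inc (E W : lmodType R) n (T : seq E -> W) (z : E) : W :=
  \sum_(i < n.+1 | (0 < i)%N) (i`!%:R : R)^-1 *: T (nseq i z).

Lemma taylor_incE (E W : lmodType R) n (T : seq E -> W) (z : E) :
  taylor n T z = T [::] + taylor_inc n T z.
Proof.
rewrite /taylor /taylor_inc big_ord_recl fact0 invr1 scale1r; congr (_ + _).
by rewrite [RHS]big_mkcond big_ord_recl /= add0r.
Qed.

(* The component of degree k of [z |-> taylor n T (\sum_(i > 0) a i)] when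
   [a i] is homogeneous of degree i in z. *)
Definition comp_coef (E W : lmodType R) n (T : seq E -> W) (a : nat -> E) k : W :=
  \sum_(j < n.+1) (j`!%:R : R)^-1 *:
    \sum_(i : {ffun 'I_j -> 'I_n.+1} |
            [forall l, (0 < i l)%N] && (\sum_l i l == k)%N)
      T [seq a (i l) | l <- enum 'I_j].

(** After multilinear expansion only the multi-indices of weight above [n] survive. Each contributes
    at most M K^j b^(n+1) with [j <= n], since [b <= 1]; the constant counts the multi-indices. *)
Lemma taylor_comp_trunc n : exists2 c : R, 0 <= c &
  forall (E W : normedModType R) (T : seq E -> W) (a : nat -> E) (M K b : R),
  symmulti n T -> 0 <= M -> 1 <= K -> 0 <= b <= 1 ->
  (forall s, (size s <= n)%N -> `|T s| <= M * \prod_(u <- s) `|u|) ->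
  (forall i, (0 < i <= n)%N -> `|a i| <= K * b ^+ i) ->
  `|\sum_(k < n.+1) comp_coef n T a k -
      taylor n T (\sum_(i < n.+1 | (0 < i)%N) a i)| <= c * (M * K ^+ n * b ^+ n.+1).
Proof.
exists (\sum_(j < n.+1) #|{ffun 'I_j -> 'I_n.+1}|%:R); first by rewrite sumr_ge0.
move=> E W T a M K b hT M0 K1 /andP[b0 b1] hM ha.
have K0 : 0 <= K by rewrite (le_trans ler01).
rewrite /comp_coef exchange_big /= /taylor -sumrB mulr_suml.
rewrite (le_trans (ler_norm_sum _ _ _)) //; apply: ler_sum => j _.
rewrite -scaler_sumr -scalerBr normrZ.
rewrite -[leRHS]mul1r ler_pM //.
  by rewrite ger0_norm ?invr_ge0 // invf_le1 ?ltr0n ?fact_gt0 // ler1n fact_gt0.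
rewrite -[nseq j _]cats0 (symmulti_expand _ _ hT); last by rewrite addn0 -ltnS.
under [X in _ - X]eq_bigr => phi _ do rewrite cats0.
rewrite (exchange_big_dep (fun phi : {ffun 'I_j -> 'I_n.+1} =>
  [forall l, (0 < phi l)%N])) /=;
  last by move=> k phi _ /andP[].
rewrite -sumrB (le_trans (ler_norm_sum _ _ _)) //.
rewrite mulr_natl -sumr_const [leLHS]big_mkcond; apply: ler_sum => phi _.
have B0 : 0 <= M * K ^+ n * b ^+ n.+1 by rewrite !mulr_ge0 // exprn_ge0.
case: ifP => // /forallP hphi.
(* A multi-index of weight at most [n] lies in exactly one [comp_coef] and cancels; a heavier one
   lies in none. *)
have [le_n|gt_n] := leqP (\sum_l phi l)%N n.
  rewrite (big_pred1 (Ordinal (le_n : (_ < n.+1)%N))) ?subrr ?normr0 //.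
  move=> k /=; rewrite -val_eqE /= eq_sym; have -> // : [forall l, (0 < phi l)%N].
  by apply/forallP.
rewrite big_pred0 ?sub0r ?normrN; last first.
  move=> k; apply/negbTE; rewrite negb_and; apply/orP; right.
  by rewrite gtn_eqF // (leq_trans (ltn_ord k)).
have jn : (j <= n)%N by rewrite -ltnS.
apply: le_trans (hM _ _) _; first by rewrite size_map size_enum_ord.
rewrite big_map -mulrA ler_wpM2l // big_enum /=.
rewrite (@le_trans _ _ (\prod_(l < j) (K * b ^+ phi l))) //.
  by apply: ler_prod => l _; rewrite normr_ge0 ha // hphi -ltnS ltn_ord.
rewrite big_split /= prodr_const card_ord -expr_sum ler_pM ?exprn_ge0 //.
  by rewrite ler_weXn2l.
by rewrite ler_wiXn2l.
Qed.

Lemma comp_coef0 (E W : lmodType R) n (T : seq E -> W) a :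
  comp_coef n T a 0 = T [::].
Proof.
rewrite /comp_coef big_ord_recl [X in _ + X]big1 ?addr0.
  rewrite fact0 invr1 scale1r (eq_bigr (fun=> T [::])) => [|phi _]; last first.
    by congr (T _); apply: size0nil; rewrite size_map size_enum_ord.
  rewrite (eq_bigl xpredT) => [|phi]; last first.
    by rewrite big_ord0 eqxx andbT; apply/forallP => -[].
  by rewrite sumr_const card_ffun !card_ord; exact: mulr1n.
move=> j _; rewrite big_pred0 ?scaler0 // => phi.
apply/negP => /andP[/forallP h]; rewrite sum_nat_eq0 => /forallP /(_ ord0) /=.
by rewrite eqn0Ngt h.
Qed.

(** This matches the range of [j] in [chain_der]: no index gives weight 0, and more than k positive
    indices have weight above k. *)
Lemma comp_coefE (E W : lmodType R) n (T : seq E -> W) a k : (0 < k <= n)%N ->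
  comp_coef n T a k = \sum_(1 <= j < k.+1) (j`!%:R : R)^-1 *:
    \sum_(i : {ffun 'I_j -> 'I_n.+1} |
            [forall l, (0 < i l)%N] && (\sum_l i l == k)%N)
      T [seq a (i l) | l <- enum 'I_j].
Proof.
move=> /andP[k0 kn]; rewrite /comp_coef -(big_mkord xpredT (fun j => (j`!%:R : R)^-1 *:
    \sum_(i : {ffun 'I_j -> 'I_n.+1} |
            [forall l, (0 < i l)%N] && (\sum_l i l == k)%N)
      T [seq a (i l) | l <- enum 'I_j])).
rewrite big_ltn // [X in _ *: X + _]big_pred0 ?scaler0 ?add0r; last first.
  by move=> phi; rewrite big_ord0 ltn_eqF // andbF.
rewrite (big_cat_nat (n := k.+1)) //= [X in _ + X]big_nat_cond [X in _ + X]big1 ?addr0 //.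
move=> j /andP[/andP[kj _] _]; rewrite big_pred0 ?scaler0 // => phi.
apply/negP => /andP[/forallP h /eqP e]; move: kj; rewrite ltnNge -e => /negP; apply.
by rewrite -[leqLHS]card_ord -sum1_card leq_sum.
Qed.

End Composition.

(** * The estimate for two close points *)

Section Near.
Context {R : realType}.

Lemma norm_factVZ (W : normedModType R) k (v : W) :
  `|(k`!%:R : R)^-1 *: v| <= `|v|.
Proof.
rewrite normrZ ler_piMl // ger0_norm ?invr_ge0 //.
by rewrite invf_le1 ?ltr0n ?fact_gt0 // ler1n fact_gt0.
Qed.

Lemma powRB_mulX (a gamma : R) k : 0 <= a -> 0 < gamma ->
  a `^ (gamma - k%:R) * a ^+ k = a `^ gamma.
Proof.
move=> a0 g0; rewrite -powR_mulrn // -powRD subrK //.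
by rewrite gt_eqF.
Qed.

Lemma taylor_inc_le (E W : normedModType R) n (T : seq E -> W) (K : R) z :
  0 <= K -> `|z| <= 1 ->
  (forall k, (0 < k <= n)%N -> `|T (nseq k z)| <= K * `|z| ^+ k) ->
  `|taylor_inc n T z| <= n.+1%:R * (K * `|z|).
Proof.
move=> K0 z1 hT; rewrite (le_trans (ler_norm_sum _ _ _)) //.
rewrite mulr_natl -[n.+1 in leRHS]card_ord -sumr_const big_mkcond.
apply: ler_sum => i _; case: ifP => [i0|_]; last by rewrite mulr_ge0.
rewrite (le_trans (norm_factVZ _ _)) // (le_trans (hT _ _)).
- by [].
- by rewrite i0 -ltnS /=.
- by rewrite ler_wpM2l // -[leRHS]expr1 ler_wiXn2l.
Qed.

(** Let w and b be the two increments of [f] and D the displacement of the centres. Insert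
    [taylor n gy (w + D)]: the first difference is made of remainders of [g] at displacement D, the
    second is a Lipschitz estimate for [gy] between w + D and b. *)
Lemma taylor_comp_near n (gamma : R) : n%:R < gamma -> 1 <= gamma ->
  exists2 c : R, 0 <= c &
  forall (E F G : normedModType R) (fx fy : seq E -> F) (gx gy : seq F -> G)
    (K M : R) (d z : E),
  1 <= K -> 0 <= M -> 0 < `|d| <= 2^-1 -> `|z| <= `|d| ->
  symmulti n fy -> symmulti n gy ->
  (forall s, (0 < size s <= n)%N -> `|fx s| <= K * \prod_(u <- s) `|u|) ->
  (forall s, (0 < size s <= n)%N -> `|fy s| <= K * \prod_(u <- s) `|u|) ->
  (forall s, (size s <= n)%N -> `|taylor_rem n fx fy d s| <=
     K * `|d| `^ (gamma - (size s)%:R) * \prod_(u <- s) `|u|) ->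
  (forall s, (size s <= n)%N -> `|gy s| <= M * \prod_(u <- s) `|u|) ->
  (forall s, (size s <= n)%N ->
     `|taylor_rem n gx gy (fx [::] - fy [::]) s| <=
     M * `|fx [::] - fy [::]| `^ (gamma - (size s)%:R) * \prod_(u <- s) `|u|) ->
  `|taylor n gx (taylor_inc n fx z) - taylor n gy (taylor_inc n fy (z + d))| <=
    c * (M * K `^ gamma * `|d| `^ gamma).
Proof.
(* [A] is n + 1 for the increment of [f] plus 1 for its remainder of order 0, both of which enter
   the bound on the displacement. *)
move=> ng g1; set A : R := n.+2%:R.
have A1 : 1 <= A by rewrite ler1n.
have A0 : 0 <= A by rewrite (le_trans ler01).
have nA : n.+1%:R <= A by rewrite ler_nat.
have g0 : 0 < gamma by rewrite (lt_le_trans ltr01).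
exists (n.+1%:R * A `^ gamma + n.+1%:R * (n%:R * n.+1%:R * (2 * A) ^+ n)).
  by rewrite addr_ge0 // !mulr_ge0 ?powR_ge0 // exprn_ge0 // mulr_ge0.
move=> E F G fx fy gx gy K M d z K1 M0 /andP[r0 r2] zr hfy hgy bfx bfy rf bgy rg.
set r := `|d| in r0 r2 zr rf *.
have K0 : 0 <= K by rewrite (le_trans ler01).
have r1 : r <= 1 by rewrite (le_trans r2) // invf_le1 ?ler1n.
have rr : r `^ gamma <= r by rewrite ge1r_powR ?r0.
set w := taylor_inc n fx z; set b := taylor_inc n fy (z + d).
set D := fx [::] - fy [::] in rg *.
have nK : 0 <= K * r by rewrite mulr_ge0 // ltW.
have wb : `|w| <= n.+1%:R * (K * r).
  apply: le_trans (taylor_inc_le K0 (le_trans zr r1) _) _.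
    by move=> k kn; rewrite -(prod_nseq k z Num.norm) bfx // size_nseq.
  by rewrite ler_wpM2l // ler_wpM2l.
have inc_fy v : `|v| <= 1 -> `|taylor_inc n fy v| <= n.+1%:R * (K * `|v|).
  move=> v1; apply: (taylor_inc_le K0 v1) => k kn.
  by rewrite -(prod_nseq k v Num.norm) bfy // size_nseq.
have zd : `|z + d| <= 2 * r.
  by rewrite (le_trans (ler_normD _ _)) // mulr_natl mulr2n lerD.
have bb : `|b| <= 2 * (A * (K * r)).
  have zd1 : `|z + d| <= 1 by rewrite (le_trans zd) // -ler_pdivlMl ?mulr1.
  apply: le_trans (inc_fy _ zd1) _.
  have -> : 2 * (A * (K * r)) = A * (K * (2 * r)) by ring.
  by rewrite ler_pM // ?mulr_ge0 // ler_wpM2l.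
have Db : `|D| <= A * (K * r).
  have -> : D = taylor_rem n fx fy d [::] + taylor_inc n fy d.
    rewrite /taylor_rem /= subn0.
    by rewrite -/(taylor n fy d) taylor_incE opprD addrA addrNK.
  rewrite (le_trans (ler_normD _ _)) // /A -natr1 mulrDl mul1r addrC lerD //.
    exact: inc_fy.
  apply: le_trans (rf [::] isT) _.
  by rewrite big_nil mulr1 subr0 ler_wpM2l.
have wA : `|w| <= A * (K * r) by rewrite (le_trans wb) // ler_wpM2r.
have aA : `|w + D| <= 2 * (A * (K * r)).
  by rewrite (le_trans (ler_normD _ _)) // mulr_natl mulr2n lerD.
set rho := 2 * A * K.
have Arho : 2 * (A * (K * r)) <= rho.
  by rewrite !mulrA ler_piMr // !mulr_ge0.
have rg0 : 0 <= r `^ gamma by rewrite powR_ge0.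
(* Up to the common constant [fy [::]], [w + D] and [b] are the Taylor polynomials of [f] at the two
   centres, so [taylor_shift] writes their difference by remainders. *)
have ab : `|w + D - b| <= n.+1%:R * (K * r `^ gamma).
  have -> : w + D - b = taylor n fx z - taylor n fy (z + d).
    by rewrite !taylor_incE opprD [RHS]addrACA -/D -/w -/b (addrC w D) addrA.
  rewrite taylor_shift // (le_trans (ler_norm_sum _ _ _)) //.
  rewrite [leRHS]mulr_natl -[n.+1 in leRHS]card_ord -sumr_const.
  apply: ler_sum => i _; rewrite (le_trans (norm_factVZ _ _)) //.
  apply: le_trans (rf _ _) _; first by rewrite size_nseq -ltnS.
  rewrite size_nseq prod_nseq -mulrA ler_wpM2l // -(powRB_mulX i (ltW r0) g0).
  by rewrite ler_wpM2l ?powR_ge0 // lerXn2r ?nnegrE ?(ltW r0).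
have -> : taylor n gx w - taylor n gy b =
    (taylor n gx w - taylor n gy (w + D)) + (taylor n gy (w + D) - taylor n gy b).
  by rewrite addrA subrK.
rewrite (le_trans (ler_normD _ _)) // mulrDl lerD //.
  rewrite taylor_shift // (le_trans (ler_norm_sum _ _ _)) //.
  rewrite -mulrA [leRHS]mulr_natl -[n.+1 in leRHS]card_ord -sumr_const.
  apply: ler_sum => i _; rewrite (le_trans (norm_factVZ _ _)) //.
  have iN : (i <= n)%N by rewrite -ltnS.
  apply: le_trans (rg _ _) _; first by rewrite size_nseq.
  rewrite size_nseq prod_nseq.
  have -> : A `^ gamma * (M * K `^ gamma * r `^ gamma) = M * (A * (K * r)) `^ gamma.
    by rewrite !powRM ?(ltW r0) //; ring.
  rewrite -mulrA ler_wpM2l // -(powRB_mulX i _ g0) ?mulr_ge0 //; last exact: ltW.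
  have gi : 0 <= gamma - i%:R.
    by rewrite subr_ge0 (le_trans _ (ltW ng)) // ler_nat.
  rewrite ler_pM ?powR_ge0 ?exprn_ge0 //.
    by rewrite ge0_ler_powR // nnegrE // mulr_ge0.
  by rewrite lerXn2r // nnegrE // mulr_ge0.
rewrite /taylor -sumrB (le_trans (ler_norm_sum _ _ _)) //.
rewrite -[leRHS]mulrA [leRHS]mulr_natl -[n.+1 in leRHS]card_ord -sumr_const.
apply: ler_sum => i _; rewrite -scalerBr (le_trans (norm_factVZ _ _)) //.
have iN : (i <= n)%N by rewrite -ltnS.
have := symmulti_lipschitz (m := i) (s := [::]) M0 hgy bgy
  (le_trans aA Arho) (le_trans bb Arho).
rewrite !cats0 addn0 big_nil mulr1 => /(_ iN) h; apply: le_trans h _.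
case: (nat_of_ord i) iN => [|j] jn.
  by rewrite !mul0r !mulr_ge0 ?powR_ge0 // exprn_ge0 // mulr_ge0.
have rho0 : 0 <= rho by rewrite !mulr_ge0.
apply: le_trans (ler_wpM2l _ ab) _; first by rewrite !mulr_ge0 // exprn_ge0.
(* The Lipschitz estimate brings K^j and the bound [ab] one more factor; j + 1 is at most n, which
   is below gamma. *)
have KK : K ^+ j.+1 <= K `^ gamma.
  by rewrite -powR_mulrn // ler_powR // (le_trans _ (ltW ng)) // ler_nat.
have AA : (2 * A) ^+ j <= (2 * A) ^+ n.
  by rewrite ler_weXn2l ?(ltnW jn) //; lra.
rewrite /= /rho exprMn.
have -> : j.+1%:R * M * ((2 * A) ^+ j * K ^+ j) * (n.+1%:R * (K * r `^ gamma)) =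
  j.+1%:R * n.+1%:R * (2 * A) ^+ j * (M * K ^+ j.+1 * r `^ gamma).
  by rewrite exprS; ring.
rewrite ler_pM //.
- by rewrite !mulr_ge0 // exprn_ge0 // mulr_ge0.
- by rewrite !mulr_ge0 // exprn_ge0.
- apply: ler_pM => //; rewrite ?exprn_ge0 ?mulr_ge0 //.
  by rewrite card_ord ler_wpM2r // ler_nat.
by rewrite ler_wpM2r // ler_wpM2l.
Qed.

End Near.

(** * The composition theorem for jets written on sequences *)

Section LipComposition.
Context {R : realType}.

Definition seq_lip (E W : normedModType R) n (gamma : R) (U : set E)
    (h : E -> seq E -> W) (M : R) :=
  0 <= M /\ forall x y s, U x -> U y -> (size s <= n)%N ->
    `|h x s| <= M * \prod_(u <- s) `|u| /\
    `|taylor_rem n (h x) (h y) (x - y) s|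
      <= M * `|x - y| `^ (gamma - (size s)%:R) * \prod_(u <- s) `|u|.

Lemma comp_coef_le n : exists2 c : R, 0 <= c &
  forall (E W : normedModType R) (T : seq E -> W) (a : nat -> E) (M K b : R) k,
  0 <= M -> 1 <= K -> 0 <= b ->
  (forall s, (size s <= n)%N -> `|T s| <= M * \prod_(u <- s) `|u|) ->
  (forall i, (0 < i <= n)%N -> `|a i| <= K * b ^+ i) ->
  `|comp_coef n T a k| <= c * (M * K ^+ n * b ^+ k).
Proof.
exists (\sum_(j < n.+1) #|{ffun 'I_j -> 'I_n.+1}|%:R); first by rewrite sumr_ge0.
move=> E W T a M K b k M0 K1 b0 hM ha.
have K0 : 0 <= K by rewrite (le_trans ler01).
rewrite /comp_coef mulr_suml.
rewrite (le_trans (ler_norm_sum _ _ _)) //; apply: ler_sum => j _.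
rewrite (le_trans (norm_factVZ _ _)) // (le_trans (ler_norm_sum _ _ _)) //.
rewrite mulr_natl -sumr_const [leLHS]big_mkcond; apply: ler_sum => phi _.
have B0 : 0 <= M * K ^+ n * b ^+ k by rewrite !mulr_ge0 // exprn_ge0.
case: ifP => // /andP[/forallP hphi /eqP <-].
have jn : (j <= n)%N by rewrite -ltnS.
apply: le_trans (hM _ _) _; first by rewrite size_map size_enum_ord.
rewrite big_map -mulrA ler_wpM2l // big_enum /=.
rewrite (@le_trans _ _ (\prod_(l < j) (K * b ^+ phi l))) //.
  by apply: ler_prod => l _; rewrite normr_ge0 ha // hphi -ltnS ltn_ord.
rewrite big_split /= prodr_const card_ord -expr_sum ler_wpM2r ?exprn_ge0 //.
by rewrite ler_weXn2l.
Qed.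

(** The link between [h], [f] and [g] is required on the diagonal only, as polarization recovers the
    rest. In the constant, [Cb] bounds the derivatives, [Cf] the remainders at distance at least
    [q], and [Cn] those at smaller distance. *)
Lemma seq_lip_comp n (gamma delta : R) :
  n%:R < gamma <= n.+1%:R -> 1 <= gamma -> 0 < delta ->
  exists2 C : R, 0 <= C &
  forall (E F G : normedModType R) (U : set E) (V : set F)
    (f : E -> seq E -> F) (g : F -> seq F -> G) (h : E -> seq E -> G) (K M : R),
  1 <= K ->
  (forall x, U x -> symmulti n (f x)) -> (forall y, V y -> symmulti n (g y)) ->
  (forall x, U x -> symmulti n (h x)) -> (forall x, U x -> V (f x [::])) ->
  (forall x s, U x -> (0 < size s <= n)%N -> `|f x s| <= K * \prod_(u <- s) `|u|) ->
  (forall x y s, U x -> U y -> (0 < size s <= n)%N ->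
     `|taylor_rem n (f x) (f y) (x - y) s|
       <= K * `|x - y| `^ (gamma - (size s)%:R) * \prod_(u <- s) `|u|) ->
  (forall x y, U x -> U y -> `|x - y| < delta ->
     `|taylor_rem n (f x) (f y) (x - y) [::]| <= K * `|x - y| `^ gamma) ->
  seq_lip n gamma V g M ->
  (forall x z k, U x -> (k <= n)%N -> h x (nseq k z) = (k`!%:R : R) *:
     comp_coef n (g (f x [::])) (fun i => (i`!%:R : R)^-1 *: f x (nseq i z)) k) ->
  seq_lip n gamma U h (C * (M * K `^ gamma)).
Proof.
move=> /andP[ng gn] g1 d0.
have g0 : 0 < gamma by rewrite (lt_le_trans ltr01).
have [cp cp0 polar] : exists2 c : R, 0 <= c & forall k, (k <= n)%N ->
    forall (E W : normedModType R) (T : seq E -> W) (B : R), 0 <= B ->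
    symmulti k T -> (forall z, `|T (nseq k z)| <= B * `|z| ^+ k) ->
    forall s, size s = k -> `|T s| <= c * B * \prod_(u <- s) `|u|.
  apply: uniform_const => [k c c' cc' P E W T B B0 hT hB s sk|k].
    by apply: le_trans (P E W T B B0 hT hB s sk) _; rewrite !ler_wpM2r // prodr_ge0.
  exact: polarization.
have [c1 c10 coef_le] := comp_coef_le n.
have [c2 c20 trunc] := @taylor_comp_trunc R n.
have [c3 c30 near] := taylor_comp_near ng g1.
have [c4 c40 pcoef] := @poly_coef_bound R n.
pose N : R := n`!%:R.
have N0 : 0 <= N by [].
have factN k : (k <= n)%N -> (k`!%:R : R) <= N.
  by move=> kn; rewrite ler_nat; apply: leq_fact.
pose Cb := cp * (N * c1).
have Cb0 : 0 <= Cb by rewrite !mulr_ge0.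
(* Below [delta] the remainder of order 0 of [f] is controlled; below 1/2 the point z + (x - y) has
   norm at most 2r, hence at most 1, as the truncation estimate demands. *)
pose q := Num.min delta 2^-1.
have q0 : 0 < q by rewrite lt_min d0 invr_gt0 ltr0n.
have q1 : q <= 1 by rewrite ge_min invf_le1 ?ler1n ?orbT.
pose Cf := Cb * (n.+2%:R * q^-1 `^ gamma).
have Cf0 : 0 <= Cf by rewrite !mulr_ge0 // powR_ge0.
(* Two truncation errors, one per centre, at arguments of norm at most 2r, and the estimate for
   close points. *)
pose Cq := c2 * 2 ^+ n.+1 + c2 * 2 ^+ n.+1 + c3.
have Cq0 : 0 <= Cq by rewrite !addr_ge0 // mulr_ge0 // exprn_ge0.
pose Cn := cp * (N * (c4 * Cq)).
have Cn0 : 0 <= Cn by rewrite !mulr_ge0.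
exists (Cb + Cf + Cn); first by rewrite !addr_ge0.
move=> E F G U V f g h K M K1 hf hg hh hUV bf rf rf0 [M0 lg] hE.
have K0 : 0 <= K by rewrite (le_trans ler01).
move BE : (M * K `^ gamma) => B.
have B0 : 0 <= B by rewrite -BE mulr_ge0 // powR_ge0.
have KB : M * K ^+ n <= B by rewrite -BE ler_wpM2l // -powR_mulrn // ler_powR // ltW.
have bg y s : V y -> (size s <= n)%N -> `|g y s| <= M * \prod_(u <- s) `|u|.
  by move=> Vy sn; have [] := lg y y s Vy Vy sn.
have ba x z i : U x -> (0 < i <= n)%N ->
    `|(i`!%:R : R)^-1 *: f x (nseq i z)| <= K * `|z| ^+ i.
  move=> Ux hi; rewrite (le_trans (norm_factVZ _ _)) //.
  by rewrite -(prod_nseq i z Num.norm) bf // size_nseq.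
have bh x s : U x -> (size s <= n)%N -> `|h x s| <= Cb * B * \prod_(u <- s) `|u|.
  move=> Ux sn; have := polar _ sn E G (h x) (N * c1 * B).
  rewrite /Cb -[cp * _ * B]mulrA; apply => //; first by rewrite !mulr_ge0.
    exact: symmulti_le (hh x Ux).
  move=> z; rewrite hE // normrZ ger0_norm // -!mulrA ler_pM // ?factN //.
  apply: le_trans (coef_le _ _ _ _ _ _ `|z| _ M0 K1 _ _ _) _ => //.
  - by move=> t tn; apply: bg => //; exact: hUV.
  - by move=> i hi; exact: ba.
  - by rewrite ler_wpM2l // ler_wpM2r // exprn_ge0.
split=> [|x y s Ux Uy sn]; first by rewrite mulr_ge0 // !addr_ge0.
have p0 : 0 <= \prod_(u <- s) `|u| by rewrite prodr_ge0.
split.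
  apply: le_trans (bh x s Ux sn) _; rewrite !ler_wpM2r //.
  by rewrite -addrA lerDl addr_ge0.
(* Coincident points are set apart, since later steps divide by [r]. *)
set r := `|x - y|; have [r0|r0] := eqVneq r 0.
  have /eqP := r0; rewrite normr_eq0 => /eqP xy.
  move/eqP: (xy); rewrite subr_eq0 => /eqP ->; rewrite subrr.
  rewrite taylor_rem0 //; last exact: hh.
  by rewrite normr0 !mulr_ge0 ?powR_ge0 // !addr_ge0.
have {}r0 : 0 < r by rewrite lt_neqAle eq_sym r0 normr_ge0.
have rg0 k : 0 <= r `^ (gamma - k%:R) by rewrite powR_ge0.
have [qr|rq] := leP q r.
  apply: (@le_trans _ _ (Cf * B * r `^ (gamma - (size s)%:R) * \prod_(u <- s) `|u|)).
    pose P : R := \prod_(u <- s) `|u|.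
    pose e : R := q^-1 `^ gamma * r `^ (gamma - (size s)%:R).
    (* As [q <= 1 <= r / q] and [i <= gamma - size s], r^i is at most (r/q)^i, hence at most
       (r/q)^(gamma - size s). *)
    have pow_e i : (size s + i <= n)%N -> r ^+ i <= e.
      move=> si; have rE : r = q * (q^-1 * r) by rewrite mulrA divff ?mul1r // gt_eqF.
      have s1 : 1 <= q^-1 * r by rewrite ler_pdivlMl // mulr1.
      have gs : i%:R <= gamma - (size s)%:R.
        by rewrite lerBrDl -natrD (le_trans _ (ltW ng)) // ler_nat.
      rewrite {1}rE exprMn (@le_trans _ _ ((q^-1 * r) ^+ i)) //.
        by rewrite ler_piMl ?exprn_ge0 ?(le_trans ler01) // exprn_ile1 // ltW.
      rewrite -powR_mulrn ?(le_trans ler01) // (le_trans (ler_powR s1 gs)) //.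
      rewrite powRM ?invr_ge0 ?(ltW q0) ?(ltW r0) // ler_wpM2r // ler_powR //.
        by rewrite invf_ge1.
      by rewrite lerBlDr lerDl.
    have -> : Cf * B * r `^ (gamma - (size s)%:R) * P =
        Cb * B * P * e + (Cb * B * P * e) *+ n.+1.
      by rewrite -mulrS -[RHS]mulr_natr /Cf /e; ring.
    have CBP : 0 <= Cb * B * P by rewrite !mulr_ge0.
    rewrite /taylor_rem (le_trans (ler_normB _ _)) // lerD //.
      apply: le_trans (bh x s Ux sn) _; rewrite -/P -[leLHS]mulr1 ler_wpM2l //.
      by rewrite -(expr0 r) pow_e // addn0.
    rewrite (le_trans (ler_norm_sum _ _ _)) //.
    apply: (@le_trans _ _ (\sum_(i < (n - size s).+1) Cb * B * P * e)); last first.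
      rewrite sumr_const card_ord ler_wpMn2l ?ltnS ?leq_subr //.
      by rewrite mulr_ge0 // mulr_ge0 // powR_ge0.
    apply: ler_sum => i _; rewrite (le_trans (norm_factVZ _ _)) //.
    have si : (size s + i <= n)%N by rewrite -leq_subRL // -ltnS.
    apply: le_trans (bh y _ Uy _) _; first by rewrite size_cat size_nseq.
    by rewrite big_cat /= prod_nseq mulrA -/P ler_wpM2l // pow_e.
  by rewrite !ler_wpM2r // addrAC lerDr addr_ge0.
apply: (@le_trans _ _ (Cn * B * r `^ (gamma - (size s)%:R) * \prod_(u <- s) `|u|));
  last by rewrite !ler_wpM2r // lerDr addr_ge0.
have rd : r < delta by move: rq; rewrite lt_min => /andP[].
have r2 : r <= 2^-1 by move: rq; rewrite lt_min => /andP[_ /ltW].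
have r1 : r <= 1 by rewrite (le_trans r2) // invf_le1 ?ler1n.
set T := taylor_rem n (h x) (h y) (x - y).
have hT : symmulti n T by apply: symmulti_rem; exact: hh.
have tayE v z : U v -> taylor n (h v) z = \sum_(k < n.+1)
    comp_coef n (g (f v [::])) (fun i => (i`!%:R : R)^-1 *: f v (nseq i z)) k.
  move=> Uv; apply: eq_bigr => k _; have kn : (k <= n)%N by rewrite -ltnS.
  by rewrite hE // scalerA mulVf ?scale1r //.
(* Here [gamma <= n + 1] is used: the truncated terms are of the order of the allowed error. *)
have rn : r ^+ n.+1 <= r `^ gamma.
  by rewrite -powR_mulrn ?(ltW r0) // ger_powR // r0 r1.
have tr v z : U v -> `|z| <= 2 * r ->
    `|taylor n (h v) z - taylor n (g (f v [::])) (taylor_inc n (f v) z)| <=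
    c2 * 2 ^+ n.+1 * (B * r `^ gamma).
  move=> Uv z2; rewrite tayE //.
  have z1 : `|z| <= 1 by rewrite (le_trans z2) // -ler_pdivlMl ?mulr1.
  apply: le_trans (trunc _ _ _ _ _ _ `|z| (hg _ (hUV _ Uv)) M0 K1 _ _ _) _.
  - by rewrite normr_ge0 z1.
  - by move=> t tn; apply: bg => //; exact: hUV.
  - by move=> i hi; exact: ba.
  have -> : c2 * 2 ^+ n.+1 * (B * r `^ gamma) = c2 * (B * (2 ^+ n.+1 * r `^ gamma)).
    by ring.
  rewrite ler_wpM2l //.
  rewrite ler_pM // ?exprn_ge0 //; first by rewrite mulr_ge0 // exprn_ge0.
  apply: (@le_trans _ _ ((2 * r) ^+ n.+1)).
    by rewrite lerXn2r // nnegrE // mulr_ge0 // ltW.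
  by rewrite exprMn ler_wpM2l // exprn_ge0.
have Qle z : `|z| <= r ->
    `|\sum_(k < n.+1) (k`!%:R : R)^-1 *: T (nseq k z)| <= Cq * (B * r `^ gamma).
  move=> zr; rewrite -taylor_shift; last exact: hh.
  have -> : taylor n (h x) z - taylor n (h y) (z + (x - y)) =
      (taylor n (h x) z - taylor n (g (f x [::])) (taylor_inc n (f x) z))
    - (taylor n (h y) (z + (x - y)) -
         taylor n (g (f y [::])) (taylor_inc n (f y) (z + (x - y))))
    + (taylor n (g (f x [::])) (taylor_inc n (f x) z) -
         taylor n (g (f y [::])) (taylor_inc n (f y) (z + (x - y)))).
    by rewrite [RHS]addrACA -opprD !subrK.
  rewrite (le_trans (ler_normD _ _)) // [Cq * _]mulrDl lerD //.
    rewrite (le_trans (ler_normB _ _)) // mulrDl lerD //.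
      by rewrite tr // (le_trans zr) // ler_peMl ?ler1n // ltW.
    rewrite tr // (le_trans (ler_normD _ _)) // mulr_natl mulr2n lerD //.
  rewrite -BE; apply: near => //.
  - by rewrite -/r r0 r2.
  - exact: hf.
  - by apply: hg; exact: hUV.
  - by move=> t; exact: bf.
  - by move=> t; exact: bf.
  - case=> [_|u t tn]; last exact: rf.
    by rewrite big_nil mulr1 subr0; exact: rf0.
  - by move=> t; apply: bg; exact: hUV.
  - by move=> t tn; have [] := lg _ _ _ (hUV _ Ux) (hUV _ Uy) tn.
(* Along t z with t in [0, 1] the bound [Qle] concerns a polynomial in t, whose coefficients are the
   remainders on the diagonal. *)
have Trk k z : (k <= n)%N -> `|z| <= r ->
    `|T (nseq k z)| <= N * (c4 * Cq) * (B * r `^ gamma).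
  move=> kn zr; have := pcoef G (fun k => (k`!%:R : R)^-1 *: T (nseq k z)).
  move=> /(_ (Cq * (B * r `^ gamma))) => H.
  have fk0 : (k`!%:R : R) != 0 by rewrite pnatr_eq0 -lt0n fact_gt0.
  have -> : T (nseq k z) = (k`!%:R : R) *: ((k`!%:R : R)^-1 *: T (nseq k z)).
    by rewrite scalerA divff // scale1r.
  rewrite normrZ ger0_norm // -!mulrA ler_pM // ?factN //.
  apply: H kn => t /andP[t0 t1].
  rewrite (eq_bigr (fun k : 'I__ => (k`!%:R : R)^-1 *: T (nseq k (t *: z)))).
    by apply: Qle; rewrite normrZ ger0_norm // (le_trans _ zr) // ler_piMl.
  move=> i _; rewrite -[nseq i (t *: z)]cats0 (symmulti_nseqZ _ _ hT) ?cats0.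
    by rewrite !scalerA mulrC.
  by rewrite addn0 -ltnS.
(* Homogeneity removes the restriction on [z]: rescaling it to norm [r] turns r^gamma into r^(gamma
   - k) |z|^k. *)
have Tk k z : (k <= n)%N ->
    `|T (nseq k z)| <= N * (c4 * Cq) * B * r `^ (gamma - k%:R) * `|z| ^+ k.
  move=> kn; pose z' := (r / `|z|) *: z.
  have z'r : `|z'| <= r.
    rewrite normrZ ger0_norm ?divr_ge0 ?(ltW r0) //.
    have [->|z0] := eqVneq `|z| 0; first by rewrite mulr0 ltW.
    by rewrite mulfVK.
  have zE : z = (`|z| / r) *: z'.
    have [z0|z0] := eqVneq z 0; first by rewrite /z' z0 !scaler0.
    by rewrite scalerA mulrA mulfVK ?gt_eqF // divff ?scale1r // normr_eq0.
  have -> : T (nseq k z) = (`|z| / r) ^+ k *: T (nseq k z').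
    rewrite {1}zE -[nseq k (_ *: z')]cats0 (symmulti_nseqZ _ _ hT) ?addn0 //.
    by rewrite cats0.
  have zr0 : 0 <= `|z| / r by rewrite divr_ge0 // ltW.
  rewrite normrZ ger0_norm ?exprn_ge0 //.
  apply: le_trans (ler_wpM2l _ (Trk k z' kn z'r)) _; first by rewrite exprn_ge0.
  rewrite -(powRB_mulX k (ltW r0) g0) expr_div_n.
  have rk : r ^+ k != 0 by rewrite expf_neq0 // gt_eqF.
  by rewrite le_eqVlt; apply/orP; left; apply/eqP; field.
have -> : Cn * B * r `^ (gamma - (size s)%:R) =
    cp * (N * (c4 * Cq) * B * r `^ (gamma - (size s)%:R)) by rewrite /Cn; ring.
apply: (polar _ sn) => //; first by rewrite !mulr_ge0.
  exact: symmulti_le hT.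
by move=> z; exact: Tk.
Qed.

End LipComposition.

(** * From tensors to sequences; norms of simple tensors *)

Section TensorSeq.
Context {R : realType} {E : lmodType R}.

(** The transport along [size v = k] is done here for an arbitrary family [P], so that it serves
    norms and derivatives alike. *)
Lemma tens_in_tuple (X : Type) (P : forall k, tpow E k -> X) k (v : k.-tuple E) :
  P k (tens v) = P (size v) (tens (in_tuple v)).
Proof.
case: v => s sz /=; have e : size s = k by exact/eqP.
case: k / e sz => sz.
by congr (P _ (tens _)); apply: val_inj.
Qed.

Lemma tpow_linear_ext (W : lmodType R) k (l1 l2 : tpow E k -> W) :
  linear l1 -> linear l2 -> (forall v, l1 (tens v) = l2 (tens v)) -> l1 =1 l2.
Proof.
move=> h1 h2 h t.
have z1 : l1 0 = 0 by have := h1 (-1) 0 0; rewrite scaler0 addr0 scaleN1r addNr.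
have z2 : l2 0 = 0 by have := h2 (-1) 0 0; rewrite scaler0 addr0 scaleN1r addNr.
have -> : t = fsum (@tens R E k) (generic_quotient.repr t).
  by rewrite fsum_tens; exact/esym/reprK.
rewrite /fsum; elim: (generic_quotient.repr t) => [|p s IH].
  by rewrite !big_nil z1 z2.
by rewrite !big_cons h1 h2 h IH.
Qed.

Lemma tact_linear k (sigma : 'S_k) : linear (@tact R E k sigma).
Proof. exact/tlift_linear/perm_multilinear. Qed.

Lemma tactM k (sigma tau : 'S_k) (t : tpow E k) :
  tact sigma (tact tau t) = tact (sigma * tau)%g t.
Proof.
apply: (tpow_linear_ext (l1 := tact sigma \o tact tau)) t => [a u v| |v] /=.
- by rewrite !tact_linear.
- exact: tact_linear.
rewrite !tact_tens; congr tens; apply: eq_from_tnth => i.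
by rewrite !tnth_mktuple permM.
Qed.

Lemma sum_tact_linear k : linear (fun v : tpow E k => \sum_(sigma : 'S_k) tact sigma v).
Proof.
move=> a u v; rewrite scaler_sumr -big_split; apply: eq_bigr => s _.
by rewrite tact_linear.
Qed.

Lemma sum_tactM k (tau : 'S_k) (v : tpow E k) :
  \sum_(sigma : 'S_k) tact sigma (tact tau v) = \sum_(sigma : 'S_k) tact sigma v.
Proof.
rewrite [RHS](reindex_inj (mulIg tau)) /=.
by apply: eq_bigr => s _; rewrite tactM.
Qed.

Lemma sum_tact_nseq k (z : E) :
  \sum_(sigma : 'S_k) tact sigma (tens (nseq_tuple k z)) =
  (k`!%:R : R) *: tens (nseq_tuple k z).
Proof.
rewrite (eq_bigr (fun=> tens (nseq_tuple k z))).
  by rewrite sumr_const card_Sn scaler_nat.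
move=> s _; rewrite tact_tens; congr tens; apply: eq_from_tnth => i.
by rewrite tnth_mktuple !tnth_nseq.
Qed.

Lemma upd_ord0 (s : seq E) x y : upd (in_tuple (x :: s)) ord0 y = in_tuple (y :: s).
Proof.
apply: eq_from_tnth => i; rewrite tnth_mktuple.
have [->|] := eqVneq i ord0; first by rewrite (tnth_nth x).
rewrite !(tnth_nth x); case: i => -[//|i] ? _ /=; exact: set_nth_default.
Qed.

End TensorSeq.

Section TensorNorm.
Context {R : realType} {E : normedModType R}.
Variable N : forall k, tpow E k -> R.
Arguments N : clear implicits.
Hypothesis hN : tensor_norms N.

(** By the triangle inequality 0 = N(t - t) is at most 2 N(t). *)
Lemma tensor_norm_ge0 k (t : tpow E k) : 0 <= N k t.
Proof.
have [/(_ k) [hD hZ _] _ _] := hN.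
have := hD t (-1 *: t); rewrite hZ scaleN1r subrr.
have -> : N k 0 = 0 by rewrite -(scale0r 0) hZ normr0 mul0r.
by rewrite normrN1 mul1r -mulr2n pmulrn_lge0.
Qed.

Lemma tensor_norm_prod k (v : k.-tuple E) : right_multiplicative N ->
  N k (tens v) = \prod_(u <- v) `|u|.
Proof.
move=> hr; rewrite (tens_in_tuple N); elim/last_ind: (tval v) => [|s w IH].
  have [_ <- _] := hN; rewrite big_nil.
  by congr (N _ (tens _)); apply: val_inj.
have h := hr _ (tens (in_tuple s)) w.
rewrite tcat_tens IH (tens_in_tuple N) /= cats1 in h; rewrite h.
by rewrite -cats1 big_cat big_seq1.
Qed.

Lemma tensor_norm_le_prod k (v : k.-tuple E) : projective N ->
  N k (tens v) <= \prod_(u <- v) `|u|.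
Proof.
move=> hp; rewrite (tens_in_tuple N); elim: (tval v) => [|w s IH].
  have [_ <- _] := hN; rewrite big_nil.
  by rewrite le_eqVlt; apply/orP; left; apply/eqP; congr (N _ (tens _)); apply: val_inj.
have [_ _ N1] := hN; rewrite big_cons.
(* [projective] concerns positive orders, hence the separate case of a single factor. *)
case: s IH => [_|u s IH].
  rewrite big_nil mulr1 -N1 le_eqVlt; apply/orP; left; apply/eqP.
  by congr (N _ (tens _)); apply: val_inj.
have h := hp 1%N _ (tens [tuple w]) (tens (in_tuple (u :: s))) isT isT.
rewrite tcat_tens N1 (tens_in_tuple N (cat_tuple _ _)) /= in h; apply: le_trans h _.
by rewrite ler_wpM2l.
Qed.

End TensorNorm.

(** * Jets, their remainders and their norms on sequences *)

Section JetEval.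
Context {R : realType} {E W : normedModType R}.
Implicit Types f : jet E W.

Definition jeval f x (s : seq E) : W :=
  if s is [::] then jbase f x else jder f x (tens (in_tuple s)).

Lemma jder_tens f x k (v : k.-tuple E) : (0 < k)%N ->
  jder f x (tens v) = jeval f x v.
Proof.
move=> k0; rewrite (tens_in_tuple (fun k => @jder _ _ _ f k x)) /jeval.
by case: (tval v) (size_tuple v) k0 => [<-|].
Qed.

Lemma const_multilinear (a : W) : multilinear (fun _ : 0.-tuple E => a).
Proof. by move=> v []. Qed.

Lemma jcomp_tens f x k (v : k.-tuple E) : jcomp f x (tens v) = jeval f x v.
Proof.
case: k v => [|k] v; last exact: jder_tens.
by rewrite /= tlift_tens ?tuple0 //; exact: const_multilinear.
Qed.

Lemma jcompZ U n f x k a (t : tpow E k) : jet_on U n f -> U x -> (k <= n)%N ->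
  jcomp f x (a *: t) = a *: jcomp f x t.
Proof.
move=> hf Ux kn; suff lin : linear (@jcomp _ _ _ f k x).
  have l0 : jcomp f x (0 : tpow E k) = 0.
    by have := lin (-1) 0 0; rewrite scaler0 addr0 scaleN1r addNr.
  by rewrite -[a *: t]addr0 lin l0 addr0.
case: k t kn => [|k] _ kn; last by have [] := hf k.+1 x kn Ux.
exact/tlift_linear/const_multilinear.
Qed.

Lemma jeval_symmulti U n f x : jet_on U n f -> U x -> symmulti n (jeval f x).
Proof.
move=> hf Ux; split=> [s t st sn|a u w s sn].
  case: t st => [/perm_nilP -> //|y t] st.
  have [p sE] := tuple_permP (t := in_tuple (y :: t)) st.
  have tn : (0 < size (y :: t) <= n)%N.
    by have <- : size s = size (y :: t) := perm_size st; rewrite sn (perm_size st).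
  have [_ sym] := hf _ _ tn Ux.
  by rewrite sE -jder_tens // -tact_tens sym.
have [lin _] := hf (size s).+1 x sn Ux.
rewrite /jeval -(upd_ord0 _ 0) (tens_multilinear (in_tuple (0 :: s))) lin.
by rewrite !upd_ord0.
Qed.

Lemma remainder_tens U n f x y k (v : k.-tuple E) :
  jet_on U n f -> U y -> (k <= n)%N ->
  remainder n f x y (tens v) =
  taylor_rem n (jeval f x) (jeval f y) (x - y) v.
Proof.
move=> hf Uy kn; rewrite /remainder /taylor_rem size_tuple jcomp_tens.
congr (_ - _); apply: eq_bigr => i _.
rewrite (jcompZ _ _ hf) // -?leq_subRL // -1?ltnS //.
by rewrite tcat_tens jcomp_tens.
Qed.

End JetEval.

Section LipSeq.
Context {R : realType}.

(** A bound linear in [M] passes to the infimum, so the norms defined as infima are themselves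
    admissible constants. *)
Lemma ler_inf_mul (S : set R) (a b : R) : S !=set0 -> 0 <= b ->
  (forall M, S M -> a <= M * b) -> a <= inf S * b.
Proof.
move=> [M0 SM0]; rewrite le_eqVlt => /predU1P[<-|b0] h.
  by have := h _ SM0; rewrite !mulr0.
rewrite -ler_pdivrMr //; apply: lb_le_inf; first by exists M0.
by move=> M SM; rewrite ler_pdivrMr // h.
Qed.

Lemma inf_ge0 (S : set R) : S !=set0 -> (forall M, S M -> 0 <= M) -> 0 <= inf S.
Proof. by move=> S0 h; apply: lb_le_inf. Qed.

Lemma lip_bound_norm (E W : normedModType R) (N : forall k, tpow E k -> R)
    (U : set E) n eps (f : jet E W) : tensor_norms N ->
  is_lip N U n eps f -> lip_bound N U n eps f (lip_norm N U n eps f).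
Proof.
move=> hN [_ ex]; split; first by apply: inf_ge0 => // M [].
move=> k x y v kn Ux Uy; split; last rewrite -mulrA; apply: ler_inf_mul => //.
- exact: tensor_norm_ge0.
- by move=> M [_ /(_ k x y v kn Ux Uy)[]].
- by rewrite mulr_ge0 ?powR_ge0 //; exact: tensor_norm_ge0.
- by move=> M [_ /(_ k x y v kn Ux Uy)[_]]; rewrite mulrA.
Qed.

Lemma rem0_bound_norm (E W : normedModType R) (U : set E) n eps delta
    (f : jet E W) : (exists M, rem0_bound U n eps delta f M) ->
  rem0_bound U n eps delta f (rem0_norm U n eps delta f).
Proof.
move=> ex; split; first by apply: inf_ge0 => // M [].
move=> x y Ux Uy xy; apply: ler_inf_mul => //.
by move=> M [_ h]; exact: h.
Qed.

Lemma lip_bound_seq (E W : normedModType R) (N : forall k, tpow E k -> R)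
    (U : set E) n eps (f : jet E W) M : tensor_norms N -> projective N ->
  jet_on U n f -> lip_bound N U n eps f M ->
  seq_lip n (n%:R + eps) U (jeval f) M.
Proof.
move=> hN hp hf [M0 h]; split=> // x y s Ux Uy sn.
have [h1 h2] := h (size s) x y (in_tuple s) sn Ux Uy.
have Ns := tensor_norm_le_prod hN (in_tuple s) hp.
split.
  by move: h1; rewrite jcomp_tens => /le_trans; apply; rewrite ler_wpM2l.
move: h2; rewrite (remainder_tens _ _ hf) // => /le_trans; apply.
by rewrite ler_wpM2l // mulr_ge0 // powR_ge0.
Qed.

Lemma seq_lip_bound (E W : normedModType R) (N : forall k, tpow E k -> R)
    (U : set E) n eps (f : jet E W) M :
  tensor_norms N -> right_multiplicative N ->
  jet_on U n f -> seq_lip n (n%:R + eps) U (jeval f) M ->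
  lip_bound N U n eps f M.
Proof.
move=> hN hr hf [M0 h]; split=> // k x y v kn Ux Uy.
have [|h1 h2] := h x y v Ux Uy; first by rewrite size_tuple.
rewrite (tensor_norm_prod hN) // jcomp_tens (remainder_tens _ _ hf) //.
by move: h2; rewrite size_tuple.
Qed.

Lemma mkclinE (E F : normedModType R) (u : E -> F) :
  linear u -> continuous u -> mkclin u =1 u.
Proof.
move=> lu cu x; rewrite /mkclin -[X in X x]/(val (insubd (0 : clin E F) u)).
by rewrite insubdK //; apply/asboolP.
Qed.

Lemma clin_sumE (E F : normedModType R) (I : Type) (r : seq I) (u : I -> clin E F) w :
  (\sum_(i <- r) u i) w = \sum_(i <- r) u i w.
Proof. exact: (big_morph (fun v : clin E F => v w)). Qed.

Lemma clinBE (E F : normedModType R) (u v : clin E F) w : (u - v) w = u w - v w.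
Proof. by []. Qed.

Lemma clinZE (E F : normedModType R) a (u : clin E F) w : (a *: u) w = a *: u w.
Proof. by []. Qed.

Section Shift.
Variables (E W : normedModType R) (U : set E) (n : nat) (f : jet E W).
Hypothesis hf : jet_on U n.+1 f.
Hypothesis hc : forall k x (v : tpow E k), (k <= n)%N -> U x ->
  continuous (jet_slice f x v).

(** [jet_slice] appends the new argument at the end; symmetry moves it to the front. *)
Lemma jeval_shift x s w : U x -> (size s <= n)%N ->
  jeval (jet_shift f) x s w = jeval f x (w :: s).
Proof.
move=> Ux sn.
have sl u : jet_slice f x (tens (in_tuple s)) u = jeval f x (u :: s).
  rewrite /jet_slice tcat_tens jder_tens ?addn1 //.
  apply: (jeval_symmulti hf Ux).1; first by rewrite /= cats1 perm_rcons.
  by rewrite /= size_cat addn1.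
have -> : jeval (jet_shift f) x s = mkclin (jet_slice f x (tens (in_tuple s))).
  case: (s) => //; congr (mkclin (jet_slice f x (tens _))); exact: val_inj.
rewrite mkclinE //; last exact: hc.
by move=> a u v; rewrite !sl (jeval_symmulti hf Ux).2.
Qed.

Lemma taylor_rem_shift x y d s w : U x -> U y -> (size s <= n)%N ->
  taylor_rem n (jeval (jet_shift f) x) (jeval (jet_shift f) y) d s w =
  taylor_rem n.+1 (jeval f x) (jeval f y) d (w :: s).
Proof.
move=> Ux Uy sn; rewrite /taylor_rem [size (w :: s)]/= subSS -jeval_shift //.
rewrite clinBE clin_sumE.
congr (_ - _); apply: eq_bigr => i _.
rewrite clinZE jeval_shift //.
by rewrite size_cat size_nseq -leq_subRL // -ltnS.
Qed.

End Shift.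

(** The orders from 1 on come from the shifted jet, whose operator norm supplies the factor of the
    extra argument; order 0 comes from the local bound on R_0. *)
Lemma alip_seq (E W : normedModType R) (N : forall k, tpow E k -> R) (U : set E)
    n (eps delta : R) (f : jet E W) (K : R) :
  tensor_norms N -> projective N -> is_alip N U n eps delta%:E f ->
  K = alip_norm N U n eps delta%:E f ->
  [/\ 0 <= K, jet_on U n f,
    (forall x s, U x -> (0 < size s <= n)%N ->
       `|jeval f x s| <= K * \prod_(u <- s) `|u|),
    (forall x y s, U x -> U y -> (0 < size s <= n)%N ->
       `|taylor_rem n (jeval f x) (jeval f y) (x - y) s|
       <= K * `|x - y| `^ (n%:R + eps - (size s)%:R) * \prod_(u <- s) `|u|) &
    (forall x y, U x -> U y -> `|x - y| < delta ->
       `|taylor_rem n (jeval f x) (jeval f y) (x - y) [::]|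
       <= K * `|x - y| `^ (n%:R + eps))].
Proof.
move=> hN hp [hl /rem0_bound_norm [K0 hr0]] KE.
have hf : jet_on U n f.
  by case: n hl {K0 hr0 KE} => [_ k x|n []//]; rewrite leqn0; case: k.
have rK : rem0_norm U n eps delta%:E f <= K.
  by rewrite KE; case: (n) => // m; rewrite /= le_max lexx orbT.
split=> // [|x s|x y s|x y Ux Uy xy]; last first.
- have := hr0 x y Ux Uy; rewrite lte_fin => /(_ xy).
  rewrite (remainder_tens _ _ hf) // => /le_trans; apply.
  by rewrite ler_wpM2r ?powR_ge0.
all: try exact: le_trans rK.
(* In degree at most 1 ([n = 0]) there is no order between 1 and [n]. *)
all: case: n hl hf KE {K0 hr0 rK} => [|n] hl hf KE; first by case: s.
all: case: hl => _ [hc hl].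
all: have [L0 hL] := lip_bound_seq hN hp hl.1 (lip_bound_norm hN hl).
all: have LK : lip_norm N U n eps (jet_shift f) <= K by rewrite KE /= le_max lexx.
all: case: s => [//|w s] Ux.
  move=> Uy sn; have [_ h] := hL x y s Ux Uy sn.
  rewrite -(taylor_rem_shift hf hc) // (le_trans (opnorm_apply _ _)) //.
  rewrite big_cons [`|w| * _]mulrC mulrA ler_wpM2r //.
  rewrite (le_trans h) // ler_wpM2r ?prodr_ge0 //.
  have -> : n.+1%:R + eps - (size (w :: s))%:R = n%:R + eps - (size s)%:R.
    by rewrite /= -!natr1; ring.
  by rewrite ler_wpM2r // powR_ge0.
move=> sn; have [h _] := hL x x s Ux Ux sn.
rewrite -(jeval_shift hf hc) // (le_trans (opnorm_apply _ _)) //.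
rewrite big_cons [`|w| * _]mulrC mulrA ler_wpM2r //.
by rewrite (le_trans h) // ler_wpM2r // prodr_ge0.
Qed.

End LipSeq.

(** * Consecutive blocks and tensor products of derivatives *)

Section Blocks.
Variables (j : nat) (i : 'I_j -> nat).

Let start n := (\sum_(m < j | (m < n)%N) i m)%N.

Lemma block_startS (l : 'I_j) :
  (\sum_(m < j | (m < l.+1)%N) i m = (\sum_(m < j | (m < l)%N) i m) + i l)%N.
Proof.
rewrite (bigD1 l) //= addnC; congr (_ + _)%N; apply: eq_bigl => m.
by rewrite ltnS [(m < l)%N]ltn_neqAle andbC.
Qed.

Lemma block_start_le m n : (m <= n)%N -> (start m <= start n)%N.
Proof.
move=> mn; rewrite /start [leqRHS](bigID (fun l : 'I_j => (l < m)%N)) /=.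
rewrite (eq_bigl (fun l : 'I_j => (l < n)%N && (l < m)%N)) ?leq_addr // => l.
by case: ltnP => [lm|]; rewrite ?andbF // andbT (leq_trans lm).
Qed.

(** The block is the predecessor of the least [n] with [p < start n]. *)
Lemma block_index p : (p < \sum_l i l)%N ->
  exists l : 'I_j, (start l <= p < start l + i l)%N.
Proof.
move=> pj; have ex : exists n, (p < start n)%N.
  by exists j; rewrite /start (eq_bigl xpredT) // => l; rewrite ltn_ord.
case: (ex_minnP ex) => -[|n] pn min; first by rewrite /start big_pred0 in pn.
have nj : (n < j)%N.
  by apply: min; rewrite /start (eq_bigl xpredT) // => l; rewrite ltn_ord.
exists (Ordinal nj); rewrite -[(start _ + _)%N]block_startS pn andbT leqNgt.
by apply/negP => /min; rewrite ltnn.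
Qed.

Lemma block_index_uniq p (l l' : 'I_j) : (start l <= p < start l + i l)%N ->
  l' != l -> ((p < start l') || (start l' + i l' <= p))%N.
Proof.
move=> /andP[lp pl]; rewrite -val_eqE neq_ltn => /orP[] ll.
  apply/orP; right; rewrite -[(start l' + _)%N]block_startS.
  by apply: leq_trans lp; exact: block_start_le.
apply/orP; left; apply: leq_trans pl _.
by rewrite -[(start l + _)%N]block_startS; exact: block_start_le.
Qed.

End Blocks.

Section TensorDer.
Context {R : realType} {E F : normedModType R}.

Lemma nth_upd k (v : k.-tuple E) (p : 'I_k) z m :
  nth 0 (upd v p z) m = if m == p then z else nth 0 v m.
Proof.
have [mk|km] := ltnP m k; last first.
  rewrite !nth_default ?size_tuple // ifN // -?(ltn_eqF (ltn_ord p)).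
  by rewrite gtn_eqF // (leq_trans (ltn_ord p)).
have -> : m = Ordinal mk by [].
by rewrite -!tnth_nth tnth_mktuple.
Qed.

Lemma block_upd_in k (v : k.-tuple E) (p : 'I_k) z o q (p' : 'I_q) :
  (o + p')%N = p -> block (upd v p z) o q = upd (block v o q) p' z.
Proof.
move=> e; apply: eq_from_tnth => a; rewrite !tnth_mktuple nth_upd -e.
by rewrite eqn_add2l.
Qed.

Lemma block_upd_out k (v : k.-tuple E) (p : 'I_k) z o q :
  ((p < o) || (o + q <= p))%N -> block (upd v p z) o q = block v o q.
Proof.
move=> h; apply: eq_from_tnth => a; rewrite !tnth_mktuple nth_upd ifN //.
by apply/eqP => e; move: h; rewrite -e; move: (ltn_ord a); lia.
Qed.

(** Changing the entry at [p] alters one block only, so linearity is that of one derivative of [f]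
    followed by that of [tens] in one slot. *)
Lemma tensor_der_multilinear U n (f : jet E F) x j (i : 'I_j -> nat) k :
  jet_on U n f -> U x -> (forall l, (0 < i l <= n)%N) -> (\sum_l i l = k)%N ->
  multilinear (fun v : k.-tuple E => tens
    [tuple jder f x (tens (block v (\sum_(m < j | (m < l)%N) i m) (i l)))
    | l < j]).
Proof.
move=> hf Ux hi ik v p a y z.
have [l /andP[lp pl]] : exists l : 'I_j, (\sum_(m < j | (m < l)%N) i m <= p <
    \sum_(m < j | (m < l)%N) i m + i l)%N by apply: block_index; rewrite ik.
set o := (\sum_(m < j | (m < l)%N) i m)%N in lp pl.
have p'P : (p - o < i l)%N by rewrite ltn_subLR.
pose t0 := [tuple jder f x (tens (block v (\sum_(m < j | (m < l)%N) i m) (i l))) | l < j].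
have E1 u : [tuple jder f x (tens (block (upd v p u)
      (\sum_(m < j | (m < l)%N) i m) (i l))) | l < j] =
    upd t0 l (jder f x (tens (upd (block v o (i l)) (Ordinal p'P) u))).
  apply: eq_from_tnth => l'; rewrite !tnth_mktuple.
  have [->|ll] := eqVneq l' l.
    by rewrite (block_upd_in _ _ (p' := Ordinal p'P)) //= subnKC.
  by rewrite block_upd_out // (block_index_uniq (l := l)) // lp.
have [lin _] := hf _ _ (hi l) Ux.
by rewrite !E1 tens_multilinear lin tens_multilinear.
Qed.

Lemma tensor_der_linear U n (f : jet E F) x j (i : 'I_j -> nat) k :
  jet_on U n f -> U x -> (forall l, (0 < i l <= n)%N) -> (\sum_l i l = k)%N ->
  linear (@tensor_der _ _ _ f x j i k).
Proof.
by move=> hf Ux hi ik; apply/tlift_linear/tensor_der_multilinear; eassumption.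
Qed.

Lemma tensor_der_nseq U n (f : jet E F) x j (i : 'I_j -> nat) k z :
  jet_on U n f -> U x -> (forall l, (0 < i l <= n)%N) -> (\sum_l i l = k)%N ->
  tensor_der f x i (tens (nseq_tuple k z)) =
  tens [tuple jeval f x (nseq (i l) z) | l < j].
Proof.
move=> hf Ux hi ik; rewrite /tensor_der tlift_tens; last first.
  by apply: tensor_der_multilinear; eassumption.
congr tens; apply: eq_from_tnth => l; rewrite !tnth_mktuple.
have -> : block (nseq_tuple k z) (\sum_(m < j | (m < l)%N) i m) (i l) =
    nseq_tuple (i l) z.
  apply: eq_from_tnth => a; rewrite tnth_mktuple tnth_nseq nth_nseq ifT //.
  rewrite -ik (leq_trans (n := (\sum_(m < j | (m < l.+1)%N) i m)%N)) //.
    by rewrite block_startS ltn_add2l.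
  by rewrite [leqRHS](bigID (fun m : 'I_j => (m < l.+1)%N)) /= leq_addr.
by have /andP[il _] := hi l; rewrite jder_tens.
Qed.

End TensorDer.

(** * Chain rule derivatives as a jet, and their diagonal values *)

Section ChainRule.
Context {R : realType} {E F G : normedModType R}.
Variables (U : set E) (V : set F) (n : nat) (f : jet E F) (g : jet F G).
Hypotheses (hf : jet_on U n f) (hg : jet_on V n g).
Hypothesis hUV : forall x, U x -> V (jbase f x).

Lemma jet_comp_on : jet_on U n (jet_comp n g f).
Proof.
move=> k x /andP[k0 kn] Ux; split=> /= [a u v|sigma v]; last first.
  by rewrite /chain_der sum_tactM.
rewrite /chain_der scaler_sumr -big_split /= big_nat_cond [RHS]big_nat_cond.
apply: eq_bigr => j /andP[/andP[j1 jk] _].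
rewrite scalerA mulrC -scalerA -scalerDr; congr (_ *: _).
rewrite scaler_sumr -big_split; apply: eq_bigr => i /andP[/forallP hi /eqP ik] /=.
have hi' l : (0 < i l <= n)%N by rewrite hi -ltnS ltn_ord.
have jn : (0 < j <= n)%N by rewrite j1 -ltnS (leq_trans jk).
have [lin _] := hg jn (hUV Ux).
rewrite sum_tact_linear (tensor_der_linear hf Ux hi' ik) scalerDr.
by rewrite scalerA mulrC -scalerA lin.
Qed.

(** On the diagonal the symmetrisation is multiplication by k!, and the factorials of the i_l are
    distributed over the arguments of [g] by multilinearity. *)
Lemma jet_comp_nseq x z k : U x -> (k <= n)%N ->
  jeval (jet_comp n g f) x (nseq k z) = (k`!%:R : R) *:
    comp_coef n (jeval g (jbase f x))
      (fun i => (i`!%:R : R)^-1 *: jeval f x (nseq i z)) k.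
Proof.
move=> Ux; case: k => [|k] kn; first by rewrite comp_coef0 fact0 scale1r.
rewrite comp_coefE // -[nseq k.+1 z]/(tval (nseq_tuple k.+1 z)) -jder_tens //=.
rewrite /chain_der scaler_sumr big_nat_cond [RHS]big_nat_cond.
apply: eq_bigr => j /andP[/andP[j1 jk] _].
rewrite [RHS]scalerA mulrC -scalerA; congr (_ *: _).
rewrite scaler_sumr; apply: eq_bigr => i /andP[/forallP hi /eqP ik] /=.
have hi' l : (0 < i l <= n)%N by rewrite hi -ltnS ltn_ord.
have jn : (j <= n)%N by rewrite -ltnS (leq_trans jk).
have jn1 : (0 < j <= n)%N by rewrite j1.
have [lin _] := hg jn1 (hUV Ux).
have sg := jeval_symmulti hg (hUV Ux).
have lZ a t : jder g (jbase f x) (a *: t : tpow F j) = a *: jder g (jbase f x) t.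
  have l0 : jder g (jbase f x) (0 : tpow F j) = 0.
    by have := lin (-1) 0 0; rewrite scaler0 addr0 scaleN1r addNr.
  by rewrite -[a *: t]addr0 lin l0 addr0.
have tZ a t : tensor_der f x (fun l => i l) (a *: t : tpow E k.+1) =
    a *: tensor_der f x (fun l => i l) t.
  have tl := tensor_der_linear hf Ux hi' ik.
  have l0 : tensor_der f x (fun l => i l) (0 : tpow E k.+1) = 0.
    by have := tl (-1) 0 0; rewrite scaler0 addr0 scaleN1r addNr.
  by rewrite -[a *: t]addr0 tl l0 addr0.
rewrite sum_tact_nseq tZ (tensor_der_nseq _ hf Ux hi' ik) !lZ jder_tens //.
rewrite scalerA mulrC -scalerA; congr (_ *: _).
rewrite -[X in _ = jeval g _ X]cats0 (symmulti_scale_prod _ _ sg).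
  rewrite cats0 natr_prod -prodfV big_enum /=; congr (_ *: jeval _ _ _).
by rewrite size_enum_ord addn0.
Qed.

End ChainRule.
Theorem theorem1p47 (R : realType) (gamma delta : R)
    (hgamma : 1 <= gamma) (hdelta : 0 < delta) :
  exists C : R,
    forall (E F G : normedModType R)
      (NE : forall k, tpow E k -> R) (NF : forall k, tpow F k -> R)
      (U : set E) (V : set F) (f : jet E F) (g : jet F G),
    tensor_norms NE -> tensor_norms NF ->
    right_multiplicative NE ->
    projective NE -> projective NF ->
    AlmostLip NE U delta%:E gamma f ->
    Lip NF V gamma g ->
    jbase f @` U `<=` V ->
    Lip NE U gamma (jet_comp (lfloor gamma) g f) /\
    LipNorm NE U gamma (jet_comp (lfloor gamma) g f)
      <= C * LipNorm NF V gamma g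
           * Num.max (AlmostLipNorm NE U delta%:E gamma f `^ gamma) 1.
Proof.
have g0 : 0 < gamma by rewrite (lt_le_trans ltr01).
have /andP[ng gn] := lfloorP g0.
set n := lfloor gamma in ng gn *.
have gE : n%:R + (gamma - n%:R) = gamma by rewrite addrC subrK.
(* The upper bound is an equality when gamma is an integer, by the convention on [lfloor]. *)
have hn : n%:R < gamma <= n.+1%:R.
  by rewrite -subr_gt0 ng /= -natr1 -lerBlDl.
have [C C0 main] := seq_lip_comp hn hgamma hdelta.
exists C => E F G NE NF U V f g hNE hNF hr hpE hpF hf hg hUV.
rewrite /Lip /LipNorm /AlmostLipNorm -/n.
set a := alip_norm NE U n (gamma - n%:R) delta%:E f.
have [a0 jf bf rf rf0] := alip_seq hNE hpE hf (erefl a).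
have bg := lip_bound_seq hNF hpF hg.1 (lip_bound_norm hNF hg).
have hUV' x : U x -> V (jbase f x) by move=> Ux; apply: hUV; exists x.
have jh := jet_comp_on jf hg.1 hUV'.
(* A bound at least 1 for [f] is needed to dominate all the powers of [K] up to order [n] by
   K^gamma. *)
pose K := Num.max a 1.
have aK : a <= K by rewrite le_max lexx.
have K1 : 1 <= K by rewrite le_max lexx orbT.
rewrite gE in rf rf0 bg.
have := main E F G U V (jeval f) (jeval g) (jeval (jet_comp n g f)) K _ K1.
move=> /(_ (lip_norm NF V n (gamma - n%:R) g)) H.
have {H}hS : seq_lip n gamma U (jeval (jet_comp n g f))
    (C * (lip_norm NF V n (gamma - n%:R) g * K `^ gamma)).
  apply: H => //.
  - by move=> x; exact: jeval_symmulti.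
  - by move=> x; apply: jeval_symmulti; exact: hg.1.
  - by move=> x; exact: jeval_symmulti.
  - move=> x s Ux sn; apply: le_trans (bf x s Ux sn) _.
    by rewrite ler_wpM2r // prodr_ge0.
  - move=> x y s Ux Uy sn; apply: le_trans (rf x y s Ux Uy sn) _.
    by rewrite ler_wpM2r ?prodr_ge0 // ler_wpM2r // powR_ge0.
  - move=> x y Ux Uy xy; apply: le_trans (rf0 x y Ux Uy xy) _.
    by rewrite ler_wpM2r // powR_ge0.
  - by move=> x z k Ux kn; exact: (jet_comp_nseq jf hg.1 hUV').
have hB : lip_bound NE U n (gamma - n%:R) (jet_comp n g f)
    (C * (lip_norm NF V n (gamma - n%:R) g * K `^ gamma)).
  by apply: seq_lip_bound => //; rewrite gE.
split; first by split=> //; eexists; exact: hB.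
(* The power gamma is monotone on nonnegative reals and fixes 1, so it commutes with the maximum. *)
have <- : K `^ gamma = Num.max (a `^ gamma) 1.
  rewrite /K; have pow_le : {in Num.nneg &, {homo (@powR R)^~ gamma : u v / u <= v}}.
    by apply: ge0_ler_powR; exact: ltW.
  have e1 : (1 : R) `^ gamma = 1 :> R by rewrite powR1.
  have [a1|/ltW a1] := leP a 1.
    by rewrite e1 max_r // -[leRHS]e1 pow_le ?nnegrE.
  by rewrite max_l // -[leLHS]e1 pow_le ?nnegrE.
rewrite -mulrA; apply: ge_inf => //.
by exists 0 => M [].
Qed.
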